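(* Let $s$ be a normalized complete Pick kernel on $X$ and $\ell$ a kernel on $X$ with $\ell/s$ positive semi-definite (and $\ell_z\neq0$ for all $z$). A sequence $\{\lambda_i\}\subset X$ is interpolating for $\mathrm{Mult}(\mathcal{H}_s,\mathcal{H}_\ell)$ if and only if it satisfies the Carleson measure condition for $\mathcal{H}_s$ and is strongly separated by $\ell$. Moreover, in this case there is a bounded linear operator $T:\ell^\infty\to\mathrm{Mult}(\mathcal{H}_s,\mathcal{H}_\ell)$ such that $[T(\{w_i\})](\lambda_j)=w_j\frac{\|\ell_{\lambda_j}\|}{\|s_{\lambda_j}\|}$ for every $\{w_i\}\in\ell^\infty$ and every $j$.
   Context: A kernel on $X$ is a positive semi-definite function $k:X\times X\to\mathbb{C}$; $\mathcal{H}_k$ its reproducing kernel Hilbert space, $k_w=k(\cdot,w)$, $\hat k_w=k_w/\|k_w\|$. A normalized complete Pick kernel is $s(z,w)=\frac{1}{1-\langle b(z),b(w)\rangle_{\mathcal K}}$ with $b$ into the open unit ball of a Hilbert space $\mathcal K$ and $b(w_0)=0$ for some $w_0$. ''$\ell/s$ positive semi-definite'' means $\ell=sg$ with $g$ a positive semi-definite kernel. $\mathrm{Mult}(\mathcal{H}_s,\mathcal{H}_\ell)$: functions $\phi$ with $f\mapsto \phi f$ bounded $\mathcal{H}_s\to\mathcal{H}_\ell$. $\{\lambda_i\}$ is interpolating for $\mathrm{Mult}(\mathcal{H}_s,\mathcal{H}_\ell)$ if for every bounded $\{w_i\}$ there is $\phi\in\mathrm{Mult}(\mathcal{H}_s,\mathcal{H}_\ell)$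 with $\phi(\lambda_i)=w_i\|\ell_{\lambda_i}\|/\|s_{\lambda_i}\|$ for all $i$. Carleson measure condition for $\mathcal{H}_s$: there is $C>0$ with $\sum_i|f(\lambda_i)|^2/\|s_{\lambda_i}\|^2\le C\|f\|^2$ for all $f\in\mathcal{H}_s$. $\{\lambda_i\}$ is strongly separated by $\ell$ if there is $\epsilon>0$ with $\mathrm{dist}(\hat\ell_{\lambda_i},\overline{\mathrm{span}}\{\hat\ell_{\lambda_j}:j\ne i\})\ge\epsilon$ for all $i$. *)

(* Defs.v *)
From HB Require Import structures.
From mathcomp Require Import all_boot all_order all_algebra.
From mathcomp Require Import reals.
From mathcomp Require Import complex.
Set Implicit Arguments. Unset Strict Implicit. Unset Printing Implicit Defensive.
Import Order.TTheory GRing.Theory Num.Theory.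
Local Open Scope ring_scope.

Section Defs.
Variable R : realType.
Local Notation C := R[i].
Variable X : Type.

(* A finite linear combination  sum_p  p.1 * k_{p.2}  of kernel functions is
   encoded as a seq of (coefficient, point).  Its squared RKHS norm is
   || sum_q a_q k_{x_q} ||^2 = sum_{p,q} conj(a_p) a_q k(x_p, x_q)
   (since <k_w, k_z> = k(z, w)). *)
Definition combo_norm2 (k : X -> X -> C) (s : seq (C * X)) : C :=
  \sum_(p <- s) \sum_(q <- s) (p.1)^* * q.1 * k p.2 q.2.

Definition psd (k : X -> X -> C) : Prop :=
  forall s : seq (C * X), 0 <= combo_norm2 k s.

Definition knorm (k : X -> X -> C) (w : X) : C := sqrtC (k w w).

(* The reproducing kernel Hilbert space H_k, realised as a space of functions
   X -> C:  f \in H_k with ||f||_{H_k} <= c  iff  for every g = sum a_q k_{x_q}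
   in the span of kernel functions,  |<f, g>| <= c ||g||,  where
   <f, g> = sum_q conj(a_q) f(x_q) by the reproducing property.
   (The span of kernels is dense, so ||f|| is the least such c.) *)
Definition rkhs_bound (k : X -> X -> C) (f : X -> C) (c : C) : Prop :=
  0 <= c /\
  forall s : seq (C * X),
    `| \sum_(q <- s) (q.1)^* * f q.2 | ^+ 2 <= c ^+ 2 * combo_norm2 k s.

Definition in_rkhs (k : X -> X -> C) (f : X -> C) : Prop :=
  exists c, rkhs_bound k f c.

Definition inner_product (V : lmodType C) (ip : V -> V -> C) : Prop :=
  [/\ forall a u v w, ip (a *: u + v) w = a * ip u w + ip v w,
      forall u v, ip v u = (ip u v)^*,
      forall u, 0 <= ip u u
    & forall u, ip u u = 0 -> u = 0].

Definition complete_ip (V : lmodType C) (ip : V -> V -> C) : Prop :=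
  forall u : nat -> V,
    (forall e : C, 0 < e -> exists N, forall m n, (N <= m)%N -> (N <= n)%N ->
        ip (u m - u n) (u m - u n) < e) ->
    exists v, forall e : C, 0 < e -> exists N, forall n, (N <= n)%N ->
        ip (u n - v) (u n - v) < e.

Definition hilbert_space (V : lmodType C) (ip : V -> V -> C) : Prop :=
  inner_product ip /\ complete_ip ip.

Definition normalized_complete_Pick (s : X -> X -> C) : Prop :=
  exists (V : lmodType C) (ip : V -> V -> C) (b : X -> V) (w0 : X),
    [/\ hilbert_space ip,
        forall z, ip (b z) (b z) < 1,
        b w0 = 0
      & forall z w, s z w = (1 - ip (b z) (b w))^-1].

Definition quotient_psd (l s : X -> X -> C) : Prop :=
  exists g, psd g /\ forall z w, l z w = s z w * g z w.

Definition mult_bound (s l : X -> X -> C) (phi : X -> C) (K : C) : Prop :=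
  0 <= K /\
  forall f c, rkhs_bound s f c -> rkhs_bound l (fun x => phi x * f x) (K * c).

Definition is_mult (s l : X -> X -> C) (phi : X -> C) : Prop :=
  exists K, mult_bound s l phi K.

Definition linf_bound (w : nat -> C) (M : C) : Prop :=
  0 <= M /\ forall i, `|w i| <= M.

Definition linf (w : nat -> C) : Prop := exists M, linf_bound w M.

Definition interpolating (s l : X -> X -> C) (lam : nat -> X) : Prop :=
  forall w, linf w ->
    exists phi, is_mult s l phi /\
      forall i, phi (lam i) = w i * knorm l (lam i) / knorm s (lam i).

(* Carleson measure condition: sum_i |f(lam_i)|^2 / ||s_{lam_i}||^2 <= C ||f||^2
   (nonnegative series: all partial sums bounded). *)
Definition carleson (s : X -> X -> C) (lam : nat -> X) : Prop :=
  exists K : C, 0 < K /\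
    forall f c, rkhs_bound s f c -> forall N,
      \sum_(i < N) `|f (lam i)| ^+ 2 / knorm s (lam i) ^+ 2 <= K * c ^+ 2.

(* Strong separation: dist(hat l_{lam i}, closed span{hat l_{lam j} : j <> i}) >= eps.
   The distance to the closed span is the infimum over finite combinations
   sum_p p.1 * hat l_{lam p.2} (p.2 <> i), and the squared norm of
   hat l_{lam i} - sum_p p.1 hat l_{lam p.2} is computed by combo_norm2. *)
Definition strongly_separated (l : X -> X -> C) (lam : nat -> X) : Prop :=
  exists eps : C, 0 < eps /\
    forall i (cs : seq (C * nat)), all (fun p => p.2 != i) cs ->
      eps ^+ 2 <= combo_norm2 l
        (((knorm l (lam i))^-1, lam i)
           :: [seq (- p.1 / knorm l (lam p.2), lam p.2) | p <- cs]).

End Defs.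

(* Main.v *)
Require Import Defs.
From HB Require Import structures.
From mathcomp Require Import all_boot all_order all_algebra.
From mathcomp Require Import all_classical reals topology normedtype.
From mathcomp Require Import complex.
From mathcomp Require Import ring.
Set Implicit Arguments. Unset Strict Implicit. Unset Printing Implicit Defensive.
Import Order.TTheory GRing.Theory Num.Theory numFieldNormedType.Exports.
Local Open Scope ring_scope.

(** Write [s = 1 / (1 - B)] with [B z w = <b z, b w>], [l = s g] and
    [t_i = |l_{lam i}| / |s_{lam i}|].

    Sufficiency. For finitely many nodes the multiplier is
    [sum_k w_k q_k phi_k / q_k (lam k)].  Here [(phi_k)] is a bounded column from [H_s]
    to [H_l (x) l^2] with [phi_k (lam i) = delta_ik t_i]: the Pick condition for such a
    column follows from the Carleson condition together with strong separation, and
    the solution is the one given by the lurking isometry, in coordinates.  And [(q_k)]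
    is a contractive row of multipliers of [H_s], hence of [H_l], with [q_k (lam k)]
    bounded below; it exists under the Carleson condition alone.  It is an analogue of
    Jones' formula: with [a = lam k] and [r = B a a], the kernel
    [poisson z w = (1 - r) (1 - r B z w) s(z,a) s(a,w)] is such that
    [damp = 1 / (1 + tau poisson)] is positive and [(1 - damp) s] dominates
    [tau psi psi^* s damp], [psi = (1 - r) s(.,a)]; ordering the nodes by decreasing [r],
    the products of the [damp]s telescope, and the Carleson condition keeps them bounded
    below at the nodes.  A mean on bounded sequences then passes to infinitely many
    nodes and keeps linearity in [w].

    Necessity. A gliding hump argument makes the norms of the interpolating multipliers
    uniform over all sign patterns [w]; choosing signs well in
    [K |sum c_i l_i|^2 >= |sum c_i w_i t_i s_i|^2] gives both conditions. *)

(** * Positive kernels *)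

Section PositiveKernels.
Variable R : realType.
Local Notation C := R[i].

Lemma ge0_conj (z : C) : 0 <= z -> z^* = z.
Proof. by move=> /ger0_real /CrealP. Qed.

Lemma conjC_mul_ge0 (z : C) : 0 <= z^* * z.
Proof. by rewrite mulrC mul_conjC_ge0. Qed.

Lemma psd_form (X J : Type) (k : X -> X -> C) (r : seq J) (c : J -> C) (x : J -> X) :
  psd k -> 0 <= \sum_(i <- r) \sum_(j <- r) (c i)^* * c j * k (x i) (x j).
Proof.
move=> kP; have := kP [seq (c i, x i) | i <- r].
rewrite /combo_norm2 big_map; congr (0 <= _).
by apply: eq_bigr => i _; rewrite big_map.
Qed.

Lemma psd_diag (X : Type) (k : X -> X -> C) (x : X) : psd k -> 0 <= k x x.
Proof.
by move=> /(@psd_form X unit k [:: tt] (fun=> 1) (fun=> x));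
  rewrite !big_seq1 conjC1 !mul1r.
Qed.

Lemma psd_form2 (X : Type) (k : X -> X -> C) (a b : C) (x y : X) : psd k ->
  0 <= a^* * a * k x x + a^* * b * k x y + b^* * a * k y x + b^* * b * k y y.
Proof.
move=> /(_ [:: (a, x); (b, y)]).
by rewrite /combo_norm2 !(big_cons, big_nil) /= !addr0 !addrA.
Qed.

Lemma psd_herm (X : Type) (k : X -> X -> C) (x y : X) : psd k -> k y x = (k x y)^*.
Proof.
move=> kP.
have h1 := ge0_conj (psd_form2 1 1 x y kP).
have h2 := ge0_conj (psd_form2 1 'i x y kP).
move: h1 h2.
rewrite !(rmorphD, rmorphM, rmorph1, rmorphN) /= !conjCK conjCi.
rewrite (ge0_conj (psd_diag x kP)) (ge0_conj (psd_diag y kP)).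
set u := k x y; set v := k y x => h1 h2.
have e1 : u^* + v^* = u + v.
  by apply/eqP; rewrite -subr_eq0; move/eqP: h1; rewrite -subr_eq0;
    congr (_ == 0); ring.
have e2 : 'i * (v^* - u^*) = 'i * (u - v).
  apply/eqP; rewrite -subr_eq0; move/eqP: h2; rewrite -subr_eq0; congr (_ == 0).
  by ring.
have e3 : v^* - u^* = u - v by apply: (mulfI (neq0Ci C)).
have : v^* *+ 2 = u *+ 2.
  have -> : v^* *+ 2 = (u^* + v^*) + (v^* - u^*) by ring.
  by rewrite e1 e3; ring.
rewrite -[v^* *+ 2]mulr_natr -[u *+ 2]mulr_natr => /mulIf h.
by rewrite -h ?conjCK // pnatr_eq0.
Qed.

Lemma psd_kernel_cst (X : Type) (a : C) : 0 <= a -> psd (fun _ _ : X => a).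
Proof.
move=> a0 s; rewrite /combo_norm2.
have -> : \sum_(p <- s) \sum_(q <- s) (p.1)^* * q.1 * a =
   (\sum_(p <- s) p.1)^* * (\sum_(q <- s) q.1) * a.
  rewrite rmorph_sum /= !mulr_suml; apply: eq_bigr => i _.
  by rewrite mulr_sumr mulr_suml.
by rewrite mulr_ge0 // conjC_mul_ge0.
Qed.

Lemma eq_psd (X : Type) (k h : X -> X -> C) : (forall x y, k x y = h x y) ->
  psd k -> psd h.
Proof.
move=> e kP s; have := kP s; rewrite /combo_norm2.
by under eq_bigr do under eq_bigr do rewrite e.
Qed.

Lemma psd_add (X : Type) (k h : X -> X -> C) :
  psd k -> psd h -> psd (fun x y => k x y + h x y).
Proof.
move=> kP hP s; have := addr_ge0 (kP s) (hP s); rewrite /combo_norm2.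
rewrite -big_split /=; congr (0 <= _); apply: eq_bigr => i _.
by rewrite -big_split /=; apply: eq_bigr => j _; rewrite mulrDr.
Qed.

Lemma psd_sum (X J : Type) (r : seq J) (k : J -> X -> X -> C) :
  (forall j, psd (k j)) -> psd (fun x y => \sum_(j <- r) k j x y).
Proof.
move=> kP; elim: r => [|j r IH].
  by apply: (eq_psd _ (@psd_kernel_cst X 0 (lexx 0))) => x y; rewrite big_nil.
by apply: (eq_psd _ (psd_add (kP j) IH)) => x y; rewrite big_cons.
Qed.

Lemma psd_pullback (X Y : Type) (k : X -> X -> C) (f : Y -> X) :
  psd k -> psd (fun y z => k (f y) (f z)).
Proof. by move=> kP s; apply: (psd_form s fst (fun p => f p.2) kP). Qed.

Lemma psd_rank1_mul (X : Type) (k : X -> X -> C) (f : X -> C) :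
  psd k -> psd (fun x y => f x * (f y)^* * k x y).
Proof.
move=> kP s.
have := psd_form s (fun p => p.1 * (f p.2)^*) (fun p => p.2) kP.
congr (0 <= _); apply: eq_bigr => i _; apply: eq_bigr => j _.
by rewrite rmorphM /= conjCK; ring.
Qed.

Lemma psd_rank1 (X : Type) (f : X -> C) : psd (fun x y => f x * (f y)^*).
Proof.
apply: (eq_psd _ (psd_rank1_mul f (@psd_kernel_cst X 1 ler01))) => x y.
by rewrite mulr1.
Qed.

Lemma psd_scale (X : Type) (k : X -> X -> C) (a : C) : 0 <= a ->
  psd k -> psd (fun x y => a * k x y).
Proof.
move=> a0 kP; apply: (eq_psd _ (psd_rank1_mul (fun=> sqrtC a) kP)) => x y.
by rewrite (ge0_conj (z := sqrtC a)) ?sqrtC_ge0 // -expr2 sqrtCK.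
Qed.

Lemma psd_combo (X : Type) (k : X -> X -> C) : psd k ->
  psd (fun s t : seq (C * X) => \sum_(p <- s) \sum_(q <- t) (p.1)^* * q.1 * k p.2 q.2).
Proof.
move=> kP S.
have := kP (flatten [seq [seq (p.1 * q.1, q.2) | q <- p.2] | p <- S]).
rewrite /combo_norm2 big_flatten big_map /=; congr (0 <= _).
apply: eq_bigr => P _; rewrite big_map.
rewrite exchange_big /= big_flatten /= big_map; apply: eq_bigr => Q _.
rewrite big_map exchange_big /= mulr_sumr; apply: eq_bigr => i _.
rewrite mulr_sumr; apply: eq_bigr => j _ /=.
by rewrite rmorphM /=; ring.
Qed.

Lemma psd_null (X : Type) (k : X -> X -> C) (x y : X) : psd k -> k y y = 0 -> k x y = 0.
Proof.
move=> kP y0; apply/eqP/negP => /negP nz.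
have p0 : 0 < `|k x y| ^+ 2 by rewrite exprn_gt0 // normr_gt0.
have x0 := psd_diag x kP.
have [t t0 te] : exists2 t : C, 0 <= t & t * `|k x y| ^+ 2 = k x x + 1.
  exists ((k x x + 1) / `|k x y| ^+ 2); last by rewrite divfK ?gt_eqF.
  by rewrite divr_ge0 // ?addr_ge0 // ltW.
have := psd_form2 1 (- t * (k x y)^*) x y kP.
rewrite y0 (psd_herm x y kP) !(rmorph1, rmorphM, rmorphN) /= (ge0_conj t0) conjCK !mulr0 !addr0.
have -> : 1 * 1 * k x x + 1 * (- t * (k x y)^*) * k x y + - t * k x y * 1 * (k x y)^* =
  k x x - 2 * (t * `|k x y| ^+ 2) by rewrite normCK; ring.
rewrite te.
have -> : k x x - 2 * (k x x + 1) = - (k x x + 2) by ring.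
by rewrite oppr_ge0 lt_geF // ltr_wpDl ?ltr0n.
Qed.

Lemma psd_schur_complement (X : Type) (k : X -> X -> C) (y : X) :
  psd k -> psd (fun x z => k x z - k x y * k y z / k y y).
Proof.
move=> kP; have [y0|ynz] := eqVneq (k y y) 0.
  by apply: (eq_psd _ kP) => x z; rewrite y0 invr0 mulr0 subr0.
move=> s; pose A := \sum_(q <- s) q.1 * k y q.2.
have yr : (k y y)^* = k y y by rewrite (ge0_conj (psd_diag y kP)).
have e1 : \sum_(q <- s) (- A / k y y)^* * q.1 * k y q.2 = - (A^* * A) / k y y.
  under eq_bigr do rewrite -mulrA; rewrite -mulr_sumr -/A.
  by rewrite !(rmorphM, rmorphN, fmorphV) /= yr; field.
have Ac : A^* = \sum_(p <- s) (p.1)^* * k p.2 y.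
  by rewrite rmorph_sum; apply: eq_bigr => p _; rewrite rmorphM /= (psd_herm y p.2 kP).
have e2 : \sum_(p <- s) \sum_(q <- (- A / k y y, y) :: s) (p.1)^* * q.1 * k p.2 q.2
   = - (A^* * A) / k y y + combo_norm2 k s.
  rewrite /combo_norm2; under eq_bigr do rewrite big_cons /=.
  rewrite big_split /=; congr (_ + _).
  rewrite Ac -mulrN !mulr_suml; apply: eq_bigr => q _; by field.
have -> : combo_norm2 (fun x z => k x z - k x y * k y z / k y y) s =
  combo_norm2 k s - A^* * A / k y y.
  rewrite /combo_norm2; under eq_bigr do under eq_bigr do rewrite mulrBr.
  under eq_bigr do rewrite sumrB; rewrite sumrB; congr (_ - _).
  rewrite Ac !mulr_suml; apply: eq_bigr => p _.
  rewrite {1}/A mulr_sumr mulr_suml; apply: eq_bigr => q _.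
  by field.
have := kP ((- A / k y y, y) :: s); rewrite {1}/combo_norm2 !big_cons /=.
rewrite e1 e2 !(rmorphM, rmorphN, fmorphV) /= yr.
by congr (0 <= _); field.
Qed.

Lemma psd_cauchy_schwarz (X : Type) (k : X -> X -> C) (x y : X) :
  psd k -> `|k x y| ^+ 2 <= k x x * k y y.
Proof.
move=> kP; have [y0|ynz] := eqVneq (k y y) 0.
  by rewrite (psd_null x kP y0) y0 normr0 expr0n mulr0.
have y0 : 0 < k y y by rewrite lt_def ynz psd_diag.
have := psd_diag x (psd_schur_complement y kP) .
rewrite subr_ge0 ler_pdivrMr // (psd_herm x y kP) normCK //.
Qed.

Lemma psd_ge_rank1 (X : Type) (k : X -> X -> C) (y : X) :
  psd k -> psd (fun x z => k x z - k x y * (k z y)^* / k y y).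
Proof.
move=> kP; apply: (eq_psd _ (psd_schur_complement y kP)) => x z.
by rewrite (psd_herm z y kP).
Qed.

Lemma psd_mul (X : Type) (k h : X -> X -> C) :
  psd k -> psd h -> psd (fun x y => k x y * h x y).
Proof.
move=> kP hP [|p0 s0]; first by rewrite /combo_norm2 big_nil.
set s := p0 :: s0; pose x i := (nth p0 s i).2.
have [k' [k'P k'0]] : exists k', [/\ psd k',
    forall i, (i < size s)%N -> forall y, k' (x i) y = 0
  & psd (fun x y => (k x y - k' x y) * h x y)].
  elim: (size s) => [|n [k' [k'P k'0 dP]]].
    exists k; split=> //; apply: (eq_psd _ (@psd_kernel_cst X 0 (lexx 0))) => u v.
    by rewrite subrr mul0r.
  exists (fun u v => k' u v - k' u (x n) * k' (x n) v / k' (x n) (x n)); split.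
  - exact: psd_schur_complement.
  - move=> i; rewrite ltnS leq_eqVlt => /orP[/eqP-> y|/k'0 i0 y]; last first.
      by rewrite !i0 !mul0r subrr.
    have [n0|nz] := eqVneq (k' (x n) (x n)) 0; last by field.
    by rewrite (psd_herm y (x n) k'P) (psd_null y k'P n0) conjC0 !mulr0 mul0r subr0.
  - have := psd_rank1_mul (fun u => k' u (x n)) (psd_scale _ hP).
    move=> /(_ (k' (x n) (x n))^-1); rewrite invr_ge0 psd_diag // => /(_ isT) rP.
    apply: (eq_psd _ (psd_add dP rP)) => u v.
    by rewrite (psd_herm v (x n) k'P); ring.
move=> /(_ s); congr (0 <= _); rewrite /combo_norm2 !(big_nth p0) !big_mkord.
apply: eq_bigr => i _; rewrite !(big_nth p0) !big_mkord; apply: eq_bigr => j _.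
by rewrite -/(x i) k'0 // subr0.
Qed.

Lemma psd_prod (X J : Type) (r : seq J) (k : J -> X -> X -> C) :
  (forall j, psd (k j)) -> psd (fun x y => \prod_(j <- r) k j x y).
Proof.
move=> kP; elim: r => [|j r IH].
  by apply: (eq_psd _ (@psd_kernel_cst X 1 ler01)) => x y; rewrite big_nil.
by apply: (eq_psd _ (psd_mul (kP j) IH)) => x y; rewrite big_cons.
Qed.

Lemma psd_exp (X : Type) (k : X -> X -> C) (n : nat) :
  psd k -> psd (fun x y => k x y ^+ n).
Proof.
move=> kP; elim: n => [|n IH]; first exact: psd_kernel_cst.
by apply: (eq_psd _ (psd_mul kP IH)) => x y; rewrite exprS.
Qed.

Lemma ge0_approx (z : C) :
  (forall e : C, 0 < e -> exists2 a : C, 0 <= a & `|z - a| <= e) -> 0 <= z.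
Proof.
move=> h; suff -> : z = `|z| by [].
apply/eqP; rewrite -subr_eq0 -normr_eq0; apply/negP => /negP nz.
have d0 : 0 < `|z - `|z| | by rewrite lt_def nz normr_ge0.
have [|a a0 ae] := h (`|z - `|z| | / 4); first by rewrite divr_gt0 ?ltr0n.
have : `|z - `|z| | <= `|z - `|z| | / 4 + `|z - `|z| | / 4.
  rewrite -{1}(subrK a z) -addrA; apply: le_trans (ler_normD _ _) _.
  apply: lerD => //; rewrite -{1}(ger0_norm a0).
  by rewrite distrC in ae; apply: le_trans (ler_dist_dist _ _) ae.
rewrite -mulrDl ler_pdivlMr ?ltr0n // -subr_ge0.
have -> : `|z - `|z| | + `|z - `|z| | - `|z - `|z| | * 4 = - (2 * `|z - `|z| |) by ring.
by rewrite oppr_ge0 lt_geF // mulr_gt0 ?ltr0n.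
Qed.

Lemma natC_unbounded (z : C) : 0 <= z -> exists n : nat, z <= n%:R.
Proof.
case: z => [u v]; rewrite lecE /= => /andP[/eqP-> u0].
exists (Num.truncn u).+1; rewrite -(rmorph_nat (real_complex R)) lecE /= eqxx /=.
by apply: ltW; rewrite truncnS_gt.
Qed.

Lemma expr_small (r d e : C) : 0 <= r -> r < 1 -> 0 <= d -> 0 < e ->
  exists n, r ^+ n * d <= e.
Proof.
move=> r0 r1 d0 e0.
have [->|rnz] := eqVneq r 0; first by exists 1%N; rewrite expr1 mul0r ltW.
have rp : 0 < r by rewrite lt_def rnz.
pose t := r^-1 - 1.
have t0 : 0 < t by rewrite subr_gt0 invf_gt1.
have bern n : 1 + n%:R * t <= r^-1 ^+ n.
  elim: n => [|n IH]; first by rewrite mul0r addr0 expr0.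
  rewrite exprS; apply: (@le_trans _ _ (r^-1 * (1 + n%:R * t))); last first.
    by rewrite ler_wpM2l // invr_ge0.
  have -> : r^-1 = 1 + t by rewrite /t; ring.
  have -> : (1 + t) * (1 + n%:R * t) = 1 + n.+1%:R * t + n%:R * t ^+ 2 by rewrite -natr1; ring.
  by rewrite lerDl mulr_ge0 ?ler0n // exprn_ge0 // ltW.
have [n hn] : exists n : nat, d / (e * t) <= n%:R.
  by apply: natC_unbounded; rewrite divr_ge0 // mulr_ge0 // ltW.
exists n; rewrite -[r]invrK exprVn mulrC ler_pdivrMr ?exprn_gt0 ?invr_gt0 //.
rewrite ler_pdivrMr ?mulr_gt0 // in hn.
apply: le_trans hn _; rewrite mulrCA ler_wpM2l ?(ltW e0) //.
by apply: le_trans (bern n); rewrite lerDr ler01.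
Qed.

Lemma psd_lt1_bound (X : Type) (k : X -> X -> C) (s : seq (C * X)) : psd k ->
  (forall x, k x x < 1) ->
  exists r : C, [/\ 0 <= r, r < 1 & forall p q, List.In p s -> List.In q s -> `|k p.2 q.2| <= r].
Proof.
move=> kP k1.
have [r [r0 r1 rs]] : exists r : C, [/\ 0 <= r, r < 1 & forall p, List.In p s -> k p.2 p.2 <= r].
  elim: s => [|p s [r [r0 r1 rs]]]; first by exists 0.
  have kr : k p.2 p.2 >=< r by rewrite real_comparable ?ger0_real ?psd_diag.
  case/orP: kr => h.
    by exists r; split=> // q [<-//|/rs].
  exists (k p.2 p.2); split=> //; first exact: psd_diag.
  by move=> q [<-//|/rs /le_trans]; apply.
exists r; split=> // p q ps qs.
rewrite -(@ler_pXn2r _ 2) ?nnegrE //.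
apply: le_trans (psd_cauchy_schwarz _ _ kP) _.
by rewrite expr2 ler_pM ?psd_diag ?rs.
Qed.

Lemma psd_lt1_neq1 (X : Type) (k : X -> X -> C) (x y : X) : psd k ->
  (forall x, k x x < 1) -> 1 - k x y != 0.
Proof.
move=> kP k1; rewrite subr_eq0; apply/negP => /eqP e.
have [r [r0 r1 /(_ (0, x) (0, y))]] := @psd_lt1_bound X k [:: (0, x); (0, y)] kP k1.
rewrite /= -e normr1 => h; suff : 1 <= r by rewrite lt_geF.
by apply: h; [left|right; left].
Qed.

Lemma ler_sum_In (J : Type) (s : seq J) (F G : J -> C) :
  (forall p, List.In p s -> F p <= G p) -> \sum_(p <- s) F p <= \sum_(p <- s) G p.
Proof.
elim: s => [|p s IH] h; first by rewrite !big_nil.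
rewrite !big_cons lerD //; first by apply: h; left.
by apply: IH => q qs; apply: h; right.
Qed.

Lemma psd_inv (X : Type) (k : X -> X -> C) : psd k -> (forall x, k x x < 1) ->
  psd (fun x y => (1 - k x y)^-1).
Proof.
move=> kP k1 s; apply: ge0_approx => e e0.
have [r [r0 r1 rs]] := psd_lt1_bound s kP k1.
pose d := \sum_(p <- s) \sum_(q <- s) `|(p.1)^* * q.1 * (1 - k p.2 q.2)^-1|.
have d0 : 0 <= d by do 2![apply: sumr_ge0 => ? _].
have [n hn] := expr_small r0 r1 d0 e0.
exists (combo_norm2 (fun x y => \sum_(i < n) k x y ^+ i) s).
  by apply: (@psd_sum X 'I_n _ (fun i x y => k x y ^+ i)) => i; apply: psd_exp.
rewrite /combo_norm2 -sumrB; apply: le_trans hn; rewrite mulr_sumr.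
apply: le_trans (ler_norm_sum _ _ _) _; apply: ler_sum_In => p ps.
rewrite -sumrB mulr_sumr; apply: le_trans (ler_norm_sum _ _ _) _; apply: ler_sum_In => q qs.
have nz := psd_lt1_neq1 p.2 q.2 kP k1.
have -> : (p.1)^* * q.1 * (1 - k p.2 q.2)^-1 - (p.1)^* * q.1 * \sum_(i < n) k p.2 q.2 ^+ i =
  k p.2 q.2 ^+ n * ((p.1)^* * q.1 * (1 - k p.2 q.2)^-1).
  have : 1 - k p.2 q.2 ^+ n = (1 - k p.2 q.2) * \sum_(i < n) k p.2 q.2 ^+ i.
    have := subrXX 1 (k p.2 q.2) n; rewrite expr1n => ->; congr (_ * _).
    by apply: eq_bigr => i _; rewrite expr1n mul1r.
  move: (\sum_(i < n) _) => S h.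
  have -> : k p.2 q.2 ^+ n = 1 - (1 - k p.2 q.2) * S by rewrite -h opprB addrC subrK.
  by field.
by rewrite normrM ler_wpM2r // normrX lerXn2r ?nnegrE // rs.
Qed.

Lemma psd_shift (X : Type) (k : X -> X -> C) (z : X) :
  psd k -> psd (fun x y => k x y - k x z - k z y + k z z).
Proof.
move=> kP.
apply: (eq_psd _ (psd_pullback (fun x => [:: (1, x); (-1, z)]) (psd_combo kP))) => x y.
by rewrite !(big_cons, big_nil) /= rmorphN rmorph1; ring.
Qed.

Lemma psd_fin (I : finType) (k : I -> I -> C) :
  (forall c : I -> C, 0 <= \sum_i \sum_j (c i)^* * c j * k i j) -> psd k.
Proof.
move=> kP s; pose c i := \sum_(q <- s | q.2 == i) q.1.
have := kP c; congr (0 <= _); rewrite /combo_norm2.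
rewrite [RHS](partition_big snd predT) //=; apply: eq_bigr => i _.
under eq_bigr do rewrite rmorph_sum /= !mulr_suml.
rewrite exchange_big /=; apply: eq_bigr => p /eqP pi.
rewrite (partition_big snd predT) //=; apply: eq_bigr => j _.
rewrite mulr_sumr mulr_suml; apply: eq_bigr => q /eqP qj.
by rewrite pi qj.
Qed.

Lemma unitmx_inj (m : nat) (M : 'M[C]_m) :
  (forall c : 'cV[C]_m, M *m c = 0 -> c = 0) -> M \in unitmx.
Proof.
move=> h; rewrite -unitmx_tr -row_free_unit -kermx_eq0.
apply/negPn/negP => /rowV0Pn [v /sub_kermxP vM /eqP[]].
by rewrite -[v]trmxK (h v^T) ?trmx0 // -[M]trmxK -trmx_mul vM trmx0.
Qed.

Section Pick.
Variables (Y : Type) (B g : Y -> Y -> C) (m : nat) (y : 'I_m -> Y) (f : 'I_m -> C).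
Hypotheses (BP : psd B) (B1 : forall x, B x x < 1) (gP : psd g).
Variable p : 'I_m -> 'I_m -> C.
Hypothesis pE : forall i j, p i j + f i * (f j)^* = g (y i) (y j) + B (y i) (y j) * p i j.
Hypothesis pP : psd p.
Hypothesis p_inj : forall c : 'I_m -> C,
  \sum_i \sum_j (c i)^* * c j * p i j = 0 -> forall i, c i = 0.

Let M z : 'M[C]_m := \matrix_(i, j) (p i j + f i * (f j)^* - B (y i) z * p i j).

Lemma pick_matrix_unit z : M z \in unitmx.
Proof.
apply: unitmx_inj => c Mc.
pose t := \sum_i \sum_j (c i 0)^* * c j 0 * p i j.
pose G := \sum_i \sum_j (c i 0)^* * c j 0 * (p i j + f i * (f j)^*).
pose U := \sum_i \sum_j (c i 0)^* * c j 0 * (B (y i) z * p i j).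
have t0 : 0 <= t by exact: (psd_form _ (fun i => c i 0) id pP).
have GU : G = U.
  apply/eqP; rewrite -subr_eq0 -sumrB big1 // => i _; rewrite -sumrB.
  have /matrixP/(_ i 0) := Mc; rewrite !mxE => e.
  transitivity ((c i 0)^* * \sum_j M z i j * c j 0); last by rewrite e mulr0.
  by rewrite mulr_sumr; apply: eq_bigr => j _; rewrite !mxE; ring.
have Uc : U^* = \sum_i \sum_j (c i 0)^* * c j 0 * (B z (y j) * p i j).
  rewrite rmorph_sum /= exchange_big /=; apply: eq_bigr => i _.
  rewrite rmorph_sum /=; apply: eq_bigr => j _.
  by rewrite 3!rmorphM /= conjCK -(psd_herm _ _ BP) -(psd_herm _ _ pP); ring.
have g0 : 0 <= \sum_i \sum_j (c i 0)^* * c j 0 * g (y i) (y j).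
  exact: (psd_form _ (fun i => c i 0) y gP).
have ff0 : 0 <= \sum_i \sum_j (c i 0)^* * c j 0 * (f i * (f j)^*).
  exact: (psd_form _ (fun i => c i 0) id (psd_rank1 f)).
have Gt : G = t + \sum_i \sum_j (c i 0)^* * c j 0 * (f i * (f j)^*).
  rewrite -big_split; apply: eq_bigr => i _; rewrite -big_split.
  by apply: eq_bigr => j _; rewrite /= mulrDr.
have Gr : U^* = G by rewrite -GU ge0_conj // Gt addr_ge0.
have := psd_form (index_enum 'I_m) (fun i => c i 0) id
  (psd_mul (psd_pullback y (psd_shift z BP)) pP).
have -> : \sum_i \sum_j (c i 0)^* * c j 0 * ((B (y i) (y j) - B (y i) z - B z (y j) + B z z) * p i j)
  = (G - \sum_i \sum_j (c i 0)^* * c j 0 * g (y i) (y j)) - U - U^* + B z z * t.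
  rewrite Uc /G /U /t mulr_sumr -!sumrB -big_split; apply: eq_bigr => i _.
  rewrite mulr_sumr -!sumrB -big_split; apply: eq_bigr => j _.
  by rewrite pE /=; ring.
rewrite Gr -GU => h.
have : t * (1 - B z z) <= 0.
  rewrite -oppr_ge0; move: (addr_ge0 (addr_ge0 h g0) ff0); congr (0 <= _).
  by rewrite Gt; ring.
rewrite pmulr_lle0 ?subr_gt0 // => tle.
have /p_inj ci : t = 0 by apply/eqP; rewrite eq_le tle.
by apply/colP => i; rewrite ci mxE.
Qed.

Lemma pick_coordinates : exists c : Y -> 'I_m -> C,
  (forall z i, \sum_j (p i j + f i * (f j)^*) * c z j =
     g (y i) z + B (y i) z * \sum_j p i j * c z j) /\
  (forall i j, c (y i) j = (j == i)%:R).
Proof.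
exists (fun z j => (invmx (M z) *m \col_i g (y i) z) j 0); split=> [z i|i j].
  set c := invmx _ *m _.
  have /matrixP/(_ i 0) : M z *m c = \col_i g (y i) z by rewrite mulKVmx ?pick_matrix_unit.
  rewrite !mxE => <-; rewrite mulr_sumr -big_split; apply: eq_bigr => j _.
  by rewrite !mxE /=; ring.
have -> : invmx (M (y i)) *m \col_k g (y k) (y i) = \col_k (k == i)%:R; last by rewrite mxE.
apply: (can_inj (mulKmx (pick_matrix_unit (y i)))); rewrite mulKVmx ?pick_matrix_unit //.
apply/colP => k; rewrite !mxE (bigD1 i) //= big1 => [|n /negPf ji].
  by rewrite !mxE eqxx pE mulr1 addr0 addrK.
by rewrite !mxE ji mulr0.
Qed.

(* Lurking isometry in coordinates: [c z] are the coordinates of the projection of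
   [g_z + b(z) (x) X_z] on the span of the vectors attached to the nodes. *)
Lemma pick_extension_aux : exists phi : Y -> C, (forall i, phi (y i) = f i) /\
  psd (fun z w => (1 - B z w)^-1 * (g z w - phi z * (phi w)^*)).
Proof.
have [c [cE c_node]] := pick_coordinates.
have [Gam GamE] : exists Gam, forall i j, Gam i j = p i j + f i * (f j)^* by eexists.
have {}cE z i : \sum_j Gam i j * c z j = g (y i) z + B (y i) z * \sum_j p i j * c z j.
  by rewrite -cE; apply: eq_bigr => j _; rewrite GamE.
have GamC i j : (Gam j i)^* = Gam i j.
  by rewrite !GamE rmorphD rmorphM /= conjCK -(psd_herm _ _ pP) [f i * _]mulrC.
pose phi z := \sum_j (c z j)^* * f j.
have [Q QE] : exists Q, forall z w, Q z w = \sum_i \sum_j (c z i)^* * c w j * p i j by eexists.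
have QP : psd Q.
  apply: (eq_psd _ (psd_pullback (fun z => [seq (c z i, i) | i <- index_enum 'I_m])
    (psd_combo pP))) => z w.
  by rewrite QE big_map; apply: eq_bigr => i _; rewrite big_map.
have [N NE] : exists N, forall z w, N z w = g z w + B z w * Q z w by eexists.
have NP : psd N.
  by apply: (eq_psd _ (psd_add gP (psd_mul BP QP))) => z w; rewrite NE.
have N_node i z : N (y i) z = \sum_j Gam i j * c z j.
  rewrite cE NE; congr (_ + _ * _); rewrite QE (bigD1 i) //= [X in _ + X]big1 => [|j /negPf ji].
    by rewrite addr0; apply: eq_bigr => j _; rewrite c_node eqxx rmorph1 mul1r mulrC.
  by rewrite big1 // => k _; rewrite c_node ji rmorph0 !mul0r.
have [S SE] : exists S, forall z w, S z w = \sum_i \sum_j (c z i)^* * c w j * Gam i j by eexists.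
exists phi; split.
  move=> i; rewrite /phi (bigD1 i) //= big1 => [|j /negPf ji].
    by rewrite c_node eqxx rmorph1 mul1r addr0.
  by rewrite c_node ji rmorph0 mul0r.
have SQ z w : S z w = Q z w + phi z * (phi w)^*.
  rewrite SE QE /phi rmorph_sum mulr_suml -big_split; apply: eq_bigr => i _ /=.
  rewrite mulr_sumr -big_split; apply: eq_bigr => j _ /=.
  by rewrite GamE rmorphM /= conjCK; ring.
have RP : psd (fun z w => N z w - S z w).
  apply: (eq_psd _ (psd_pullback
    (fun z => (1, z) :: [seq (- c z i, y i) | i <- index_enum 'I_m]) (psd_combo NP))) => z w.
  rewrite !big_cons /= !big_map rmorph1 /=.
  have -> : \sum_j 1 * - c w j * N z (y j) = - S z w.
    rewrite SE exchange_big /= -sumrN; apply: eq_bigr => j _.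
    rewrite (psd_herm (y j) z NP) N_node rmorph_sum mulr_sumr -sumrN.
    by apply: eq_bigr => i _; rewrite rmorphM /= GamC; ring.
  have e i : \sum_(q <- (1, w) :: [seq (- c w j, y j) | j <- index_enum 'I_m])
      (- c z i)^* * q.1 * N (y i) q.2 = 0.
    rewrite big_cons big_map /= N_node mulr1 mulr_sumr -big_split big1 // => j _ /=.
    rewrite N_node (bigD1 j) //= big1 => [|k /negPf kj]; last by rewrite c_node kj mulr0.
    by rewrite c_node eqxx rmorphN /= mulr1 addr0; ring.
  under [X in _ + X]eq_bigr do rewrite e.
  by rewrite big1 // addr0 !mul1r.
have sP := psd_inv BP B1.
apply: (eq_psd _ (psd_add QP (psd_mul sP RP))) => z w.
rewrite SQ NE; have nz := psd_lt1_neq1 z w BP B1.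
by field.
Qed.

End Pick.

Lemma pick_extension (Y : Type) (B g : Y -> Y -> C) (m : nat) (y : 'I_m -> Y)
    (f : 'I_m -> C) :
  psd B -> (forall x, B x x < 1) -> psd g ->
  (forall c : 'I_m -> C,
     let e := \sum_i \sum_j (c i)^* * c j *
       ((1 - B (y i) (y j))^-1 * (g (y i) (y j) - f i * (f j)^*)) in
     0 <= e /\ (e = 0 -> forall i, c i = 0)) ->
  exists phi : Y -> C, (forall i, phi (y i) = f i) /\
    psd (fun z w => (1 - B z w)^-1 * (g z w - phi z * (phi w)^*)).
Proof.
move=> BP B1 gP h.
pose p i j := (1 - B (y i) (y j))^-1 * (g (y i) (y j) - f i * (f j)^*).
apply: (@pick_extension_aux _ _ _ _ _ _ BP B1 gP p) => [i j||c].
- rewrite /p; have nz := psd_lt1_neq1 (y i) (y j) BP B1.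
  by field.
- by apply: psd_fin => c; have [] := h c.
- by have [] := h c.
Qed.

Section Multipliers.
Variables (X : Type) (s l : X -> X -> C).
Hypotheses (sP : psd s) (lP : psd l).

Lemma rkhs_bound_combo (t : seq (C * X)) :
  rkhs_bound s (fun x => \sum_(q <- t) q.1 * s x q.2) (sqrtC (combo_norm2 s t)).
Proof.
split=> [|u]; first by rewrite sqrtC_ge0.
have := psd_cauchy_schwarz u t (psd_combo sP); rewrite sqrtCK mulrC; congr (`|_| ^+ 2 <= _).
apply: eq_bigr => p _; rewrite mulr_sumr; apply: eq_bigr => q _; ring.
Qed.

Lemma combo_mult (phi : X -> C) (K : C) (t : seq (C * X)) :
  combo_norm2 (fun x y => K * l x y - phi x * (phi y)^* * s x y) t =
  K * combo_norm2 l t - combo_norm2 s [seq (q.1 * (phi q.2)^*, q.2) | q <- t].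
Proof.
rewrite /combo_norm2 big_map mulr_sumr -sumrB; apply: eq_bigr => p _.
rewrite big_map mulr_sumr -sumrB; apply: eq_bigr => q _ /=.
by rewrite rmorphM /= conjCK; ring.
Qed.

Lemma mult_boundP (phi : X -> C) (K : C) : mult_bound s l phi K <->
  0 <= K /\ psd (fun x y => K ^+ 2 * l x y - phi x * (phi y)^* * s x y).
Proof.
split=> -[K0 h]; split=> //.
- move=> t; rewrite combo_mult subr_ge0.
  set t' := [seq _ | q <- t]; set n := combo_norm2 s t'.
  have n0 : 0 <= n by exact: sP.
  have [_ /(_ t)] := h _ _ (rkhs_bound_combo t').
  have -> : \sum_(q <- t) (q.1)^* * (phi q.2 * (\sum_(q0 <- t') q0.1 * s q.2 q0.2)) = n.
    rewrite /n /combo_norm2 big_map; apply: eq_bigr => p _ /=.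
    rewrite !mulr_sumr; apply: eq_bigr => q _; rewrite rmorphM /= conjCK; ring.
  rewrite exprMn sqrtCK (ger0_norm n0).
  have [->|nz] := eqVneq n 0; first by rewrite mulr_ge0 ?exprn_ge0 // lP.
  by rewrite -mulrA mulrCA expr2 ler_pM2l // lt_def nz.
- move=> f c [c0 fc]; split=> [|t]; first by rewrite mulr_ge0.
  have := fc [seq (q.1 * (phi q.2)^*, q.2) | q <- t].
  rewrite big_map; set L := \sum_(q <- t) _; set L' := \sum_(q <- t) _.
  have -> : L = L'.
    by apply: eq_bigr => q _; rewrite /= rmorphM /= conjCK mulrA.
  move=> /le_trans; apply.
  have -> : (K * c) ^+ 2 * combo_norm2 l t = c ^+ 2 * (K ^+ 2 * combo_norm2 l t) by ring.
  have := h t; rewrite combo_mult subr_ge0 => h'.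
  by apply: ler_wpM2l; rewrite ?exprn_ge0.
Qed.
End Multipliers.

End PositiveKernels.

(** * Contractive rows from the Carleson condition *)

Section Row.
Variable R : realType.
Local Notation C := R[i].
Variables (X : Type) (B : X -> X -> C).
Hypotheses (BP : psd B) (B1 : forall x, B x x < 1).

Definition pick_kernel (z w : X) : C := (1 - B z w)^-1.
Local Notation s := pick_kernel.

Lemma pick_kernel_psd : psd s. Proof. exact: psd_inv. Qed.
Lemma pick_kernel_sub_neq0 z w : 1 - B z w != 0. Proof. exact: psd_lt1_neq1. Qed.
Lemma pick_kernel_conj z w : (s z w)^* = s w z.
Proof. by rewrite -(psd_herm _ _ pick_kernel_psd). Qed.

Section Damping.
Variables (tau : C) (a : X).
Hypothesis tau0 : 0 <= tau.
Local Notation r := (B a a).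

Definition poisson (z w : X) : C := (1 - r) * (1 - r * B z w) * (s z a * s a w).
Definition damp (z w : X) : C := (1 + tau * poisson z w)^-1.

Let r1 : 0 < 1 - r. Proof. by rewrite subr_gt0. Qed.
Let h := 1 + tau * (1 - r).
Let h1 : 1 <= h. Proof. by rewrite /h lerDl mulr_ge0 // ltW. Qed.
Let h0 : 0 < h. Proof. exact: lt_le_trans ltr01 h1. Qed.
Let u z := 1 - B z a / h.
Let N z w := tau * (1 - r) * (r * B z w - B z a * B a w / h).
Let D z w := (1 - B z a) * (1 - B a w) + tau * (1 - r) * (1 - r * B z w).

Let uC w : (u w)^* = 1 - B a w / h.
Proof.
by rewrite /u rmorphB rmorph1 rmorphM fmorphV /= -(psd_herm _ _ BP) (ge0_conj (ltW h0)).
Qed.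

Let DE z w : D z w = h * (u z * (u w)^*) - N z w.
Proof.
have hn : h != 0 by rewrite gt_eqF.
rewrite uC /D /u /N.
have e : tau * (1 - r) = h - 1 by rewrite /h; ring.
by rewrite e; field.
Qed.

Let NP : psd N.
Proof.
apply: psd_scale; first by rewrite mulr_ge0 // ltW.
have hh : 0 <= 1 - h^-1 by rewrite subr_ge0 invf_le1.
have P2 := psd_scale hh (psd_rank1 (fun z => B z a)).
apply: (eq_psd _ (psd_add (psd_scale (psd_diag a BP) (psd_schur_complement a BP)) P2)) => z w.
rewrite -(psd_herm _ _ BP).
have [r0|rn] := eqVneq r 0; last by field; rewrite rn gt_eqF.
by rewrite (psd_null z BP r0) r0; ring.
Qed.

Lemma poisson_bracket_gt0 z : 0 < 1 - r * B z z.
Proof.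
rewrite subr_gt0; apply: le_lt_trans (B1 z).
by rewrite ler_piMl ?psd_diag // ltW.
Qed.

Let D_gt0 z : tau != 0 -> 0 < D z z.
Proof.
move=> tn; rewrite /D; apply: ltr_wpDl.
  have -> : 1 - B a z = (1 - B z a)^* by rewrite rmorphB rmorph1 /= -(psd_herm _ _ BP).
  exact: mul_conjC_ge0.
by rewrite !mulr_gt0 // ?poisson_bracket_gt0 // lt_def tn.
Qed.

Hypothesis tau_neq0 : tau != 0.

Let u_neq0 z : u z != 0.
Proof.
apply/negP => /eqP uz; have := D_gt0 z tau_neq0.
by rewrite DE uz mul0r mulr0 sub0r oppr_gt0 le_gtF // psd_diag.
Qed.

Let M z w := N z w / (h * (u z * (u w)^*)).

Let uV z w : u z * (u w)^* != 0. Proof. by rewrite mulf_neq0 ?conjC_eq0. Qed.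

Let MP : psd M.
Proof.
have hi : 0 <= h^-1 by rewrite invr_ge0 ltW.
apply: (eq_psd _ (psd_scale hi (psd_rank1_mul (fun z => (u z)^-1) NP))) => z w.
rewrite /M fmorphV /=; field; rewrite conjC_eq0 !u_neq0 gt_eqF //.
Qed.

Let M1 z : M z z < 1.
Proof.
have p : 0 < h * (u z * (u z)^*).
  by rewrite mulr_gt0 // lt_def uV mul_conjC_ge0.
by rewrite /M ltr_pdivrMr // mul1r -subr_gt0 -DE D_gt0.
Qed.

Let D_neq0 z w : D z w != 0.
Proof.
have hn : h != 0 by rewrite gt_eqF.
have -> : D z w = (1 - M z w) * (h * (u z * (u w)^*)).
  by rewrite DE /M; field; rewrite conjC_eq0 !u_neq0.
by rewrite !mulf_neq0 ?conjC_eq0 // psd_lt1_neq1.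
Qed.

Let denE z w : 1 + tau * poisson z w = D z w * (s z a * s a w).
Proof.
have n1 := pick_kernel_sub_neq0 z a; have n2 := pick_kernel_sub_neq0 a w.
by rewrite /poisson /D /s; field; rewrite n1 n2.
Qed.

Lemma damp_den_neq0 z w : 1 + tau * poisson z w != 0.
Proof. by rewrite denE mulf_neq0 // mulf_neq0 // invr_neq0 // pick_kernel_sub_neq0. Qed.

Lemma damp_psd : psd damp.
Proof.
have hi : 0 <= h^-1 by rewrite invr_ge0 ltW.
have hn : h != 0 by rewrite gt_eqF.
apply: (eq_psd _ (psd_scale hi (psd_rank1_mul (fun z => (1 - B z a) / u z) (psd_inv MP M1)))) => z w.
have n1 := pick_kernel_sub_neq0 z a; have n2 := pick_kernel_sub_neq0 a w.
have nD := D_neq0 z w.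
rewrite /damp denE /s rmorphM fmorphV /= rmorphB rmorph1 /= -(psd_herm _ _ BP).
have -> : 1 - M z w = D z w / (h * (u z * (u w)^*)).
  by rewrite DE /M; field; rewrite conjC_eq0 !u_neq0.
by field; rewrite conjC_eq0 !u_neq0 n1 n2 nD.
Qed.

Lemma damp_gap : psd (fun z w => (1 - damp z w) * s z w -
  tau * ((1 - r) * s z a * ((1 - r) * s w a)^*) * s z w * damp z w).
Proof.
have c0 : 0 <= tau * (r * (1 - r)) by rewrite !mulr_ge0 ?psd_diag // ltW.
apply: (eq_psd _ (psd_scale c0 (psd_rank1_mul (fun z => s z a) damp_psd))) => z w.
rewrite rmorphM /= (ge0_conj (ltW r1)) pick_kernel_conj /damp.
have := damp_den_neq0 z w; rewrite /poisson => nd.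
have n3 := pick_kernel_sub_neq0 z w.
have sE : B z w * s z w = s z w - 1 by rewrite /s; field.
have : (1 - r * B z w) * s z w = r + (1 - r) * s z w.
  by rewrite mulrBl mul1r -mulrA sE; ring.
move: nd; set b := B z w; set S := s z w; set S1 := s z a; set S2 := s a w => nd e.
transitivity ((1 + tau * ((1 - r) * (1 - r * b) * (S1 * S2)))^-1 *
  (tau * (1 - r) * S1 * S2 * (((1 - r * b) * S) - (1 - r) * S))).
  by rewrite e; field.
by field.
Qed.

Lemma poisson_ge0 z : 0 <= poisson z z.
Proof.
apply: mulr_ge0; first by rewrite mulr_ge0 ?(ltW r1) ?(ltW (poisson_bracket_gt0 z)).
by rewrite -[s a z]pick_kernel_conj mul_conjC_ge0.
Qed.

Lemma poisson_le z : B z z <= r ->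
  poisson z z <= 2 * ((1 - r) * (1 - B z z) * `|s a z| ^+ 2).
Proof.
move=> zr; rewrite normCK pick_kernel_conj /poisson.
have p0 : 0 <= s z a * s a z by rewrite -[s a z]pick_kernel_conj mul_conjC_ge0.
have -> : 2 * ((1 - r) * (1 - B z z) * (s a z * s z a)) =
  (1 - r) * (2 * (1 - B z z)) * (s z a * s a z) by ring.
apply: ler_wpM2r => //; apply: ler_wpM2l; first exact: ltW.
rewrite -subr_ge0.
have -> : 2 * (1 - B z z) - (1 - r * B z z) = (r - B z z) + (1 - r) * (1 - B z z) by ring.
by rewrite addr_ge0 ?subr_ge0 // mulr_ge0 ?(ltW r1) // subr_ge0 ltW.
Qed.

End Damping.

Lemma prod_inv1D_ge (J : eqType) (L : seq J) (x : J -> C) :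
  (forall j, 0 <= x j) ->
  1 - \sum_(j <- L) x j <= \prod_(j <- L) (1 + x j)^-1 <= 1 /\ 0 < \prod_(j <- L) (1 + x j)^-1.
Proof.
move=> x0; elim: L => [|j L [/andP[IH1 IH2] IH3]].
  by rewrite !big_nil subr0 lexx ltr01.
have x1 : 0 < 1 + x j by rewrite ltr_wpDr.
rewrite !big_cons; set P := \prod_(j <- L) _ in IH1 IH2 IH3 *; set S := \sum_(j <- L) _ in IH1 *.
split; last by rewrite mulr_gt0 // invr_gt0.
apply/andP; split; last by rewrite mulr_ile1 ?invr_ge0 ?(ltW x1) ?(ltW IH3) // invf_le1 // lerDl.
rewrite mulrC ler_pdivlMr //.
apply: (@le_trans _ _ ((P - x j) * (1 + x j))).
  apply: ler_wpM2r; first exact: ltW.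
  by rewrite opprD addrCA addrC lerD2r.
rewrite -subr_ge0; have -> : P - (P - x j) * (1 + x j) = (1 - P) * x j + x j ^+ 2 by ring.
by rewrite addr_ge0 ?exprn_ge0 // mulr_ge0 // subr_ge0.
Qed.

(* Jones' interpolation formula, with the exponential weights replaced by the
   kernels [damp]; the product telescopes. *)
Lemma row_sorted (a : nat -> X) (tau S : C) (L : seq nat) :
  0 < tau -> tau * (2 * S) <= 2^-1 -> uniq L ->
  pairwise (fun m k => B (a k) (a k) <= B (a m) (a m)) L ->
  (forall k, \sum_(m <- L) (1 - B (a m) (a m)) * (1 - B (a k) (a k)) * `|s (a m) (a k)| ^+ 2 <= S) ->
  exists q : nat -> X -> C,
    psd (fun z w => s z w * (1 - \prod_(m <- L) damp tau (a m) z w)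
       - (\sum_(k <- L) q k z * (q k w)^*) * s z w) /\
    forall k, k \in L -> tau / 2 <= `|q k (a k)| ^+ 2.
Proof.
move=> tau0 tauS; elim/last_ind: L => [|L k IH].
  move=> _ _ _; exists (fun _ _ => 0); split=> //.
  apply: (eq_psd _ (@psd_kernel_cst R X 0 (lexx 0))) => z w.
  by rewrite !big_nil subrr mulr0 mul0r subrr.
rewrite rcons_uniq pairwise_rcons => /andP[kL Lu] /andP[Lk Lp] Sk.
have t0 := ltW tau0; have tn : tau != 0 by rewrite gt_eqF.
have [j|q [qP qk]] := IH Lu Lp.
  apply: le_trans (Sk j); rewrite -cats1 big_cat /= lerDl big_seq1.
  by rewrite !mulr_ge0 ?exprn_ge0 // subr_ge0 ltW.
pose W z w := \prod_(m <- rcons L k) damp tau (a m) z w.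
have WP : psd W by apply: psd_prod => j; exact: damp_psd.
have WLP : psd (fun z w => \prod_(m <- L) damp tau (a m) z w).
  by apply: psd_prod => j; exact: damp_psd.
have WE z w : W z w = (\prod_(m <- L) damp tau (a m) z w) * damp tau (a k) z w.
  by rewrite /W -cats1 big_cat big_seq1.
have [x0 [xs Wp]] : (forall m, 0 <= tau * poisson (a m) (a k) (a k)) /\
    1 - \sum_(m <- rcons L k) tau * poisson (a m) (a k) (a k) <= W (a k) (a k) /\ 0 < W (a k) (a k).
  have x0 m : 0 <= tau * poisson (a m) (a k) (a k) by rewrite mulr_ge0 ?poisson_ge0.
  by have [/andP[? _] ?] := prod_inv1D_ge (rcons L k) x0; split.
have Wh : 2^-1 <= W (a k) (a k).
  apply: le_trans xs.
  have e2 : 1 - 2^-1 = 2^-1 :> C by field.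
  rewrite -e2 lerD2l lerN2; apply: le_trans tauS; rewrite -mulr_sumr.
  apply: ler_wpM2l => //; apply: le_trans (ler_wpM2l _ (Sk k)); last by rewrite ler0n.
  rewrite mulr_sumr !big_seq; apply: ler_sum => m mL; apply: poisson_le.
  move: mL; rewrite mem_rcons inE => /orP[/eqP->//|mL].
  by move/allP: Lk => /(_ _ mL).
pose qn z := sqrtC tau * ((1 - B (a k) (a k)) * s z (a k)) * (W z (a k) / sqrtC (W (a k) (a k))).
have qnP : psd (fun z w => (\prod_(m <- L) damp tau (a m) z w) * ((1 - damp tau (a k) z w) * s z w)
   - qn z * (qn w)^* * s z w).
  have P1 := psd_mul WLP (damp_gap (a k) t0 tn).
  have P2 := psd_scale t0 (psd_rank1_mul (fun z => (1 - B (a k) (a k)) * s z (a k))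
     (psd_mul pick_kernel_psd (psd_ge_rank1 (a k) WP))).
  apply: (eq_psd _ (psd_add P1 P2)) => z w.
  have e : qn z * (qn w)^* =
     tau * ((1 - B (a k) (a k)) * s z (a k) * ((1 - B (a k) (a k)) * s w (a k))^*) *
     (W z (a k) * (W w (a k))^* / W (a k) (a k)).
    rewrite /qn !(rmorphM, fmorphV) /= !(ge0_conj (z := sqrtC _)) ?sqrtC_ge0 ?(ltW Wp) //.
    have [tE VE] : tau = sqrtC tau ^+ 2 /\ W (a k) (a k) = sqrtC (W (a k) (a k)) ^+ 2.
      by rewrite !sqrtCK.
    have : sqrtC (W (a k) (a k)) != 0 by rewrite sqrtC_eq0 gt_eqF.
    move: tE VE; move: (sqrtC tau) (sqrtC (W _ _)) => T V -> -> Vn.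
    move: (_ / (1 - B w (a k))^*) => x; by field.
  by rewrite e WE; ring.
exists (fun j => if j == k then qn else q j); split.
  apply: (eq_psd _ (psd_add qP qnP)) => z w; rewrite -[in RHS]cats1 !big_cat !big_seq1 /= eqxx.
  have -> : \sum_(j <- L) (if j == k then qn else q j) z * ((if j == k then qn else q j) w)^* =
     \sum_(j <- L) q j z * (q j w)^*.
    rewrite !big_seq; apply: eq_bigr => j jL; case: eqP => // jk.
    by rewrite -jk jL in kL.
  by ring.
move=> j; rewrite mem_rcons inE => /orP[/eqP->|jL]; last first.
  by case: eqP => [jk|_]; [rewrite -jk jL in kL|exact: qk].
rewrite eqxx /qn.
have nz : 1 - B (a k) (a k) != 0 by exact: pick_kernel_sub_neq0.
rewrite /s mulfV // mulr1.
have -> : W (a k) (a k) / sqrtC (W (a k) (a k)) = sqrtC (W (a k) (a k)).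
  by rewrite -{1}(sqrtCK (W (a k) (a k))) expr2 mulfK // sqrtC_eq0 gt_eqF.
rewrite normrM exprMn !ger0_norm ?sqrtC_ge0 ?(ltW Wp) // !sqrtCK.
exact: ler_wpM2l.
Qed.

Lemma row_multiplier (a : nat -> X) (S : C) (n : nat) : 0 < S ->
  (forall k, \sum_(m < n) (1 - B (a m) (a m)) * (1 - B (a k) (a k)) * `|s (a m) (a k)| ^+ 2 <= S) ->
  exists q : nat -> X -> C,
    psd (fun z w => (1 - \sum_(k < n) q k z * (q k w)^*) * s z w) /\
    forall k, (k < n)%N -> (8 * S)^-1 <= `|q k (a k)| ^+ 2.
Proof.
move=> S0 Sk; pose tau := (4 * S)^-1.
have tau0 : 0 < tau by rewrite invr_gt0 mulr_gt0.
pose ge m k := B (a k) (a k) <= B (a m) (a m).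
pose L := sort ge (iota 0 n).
have Lp : perm_eq L (index_iota 0 n) by rewrite perm_sort /index_iota subn0.
have [||||q [qP qk]] := @row_sorted a tau S L tau0.
- have -> : tau * (2 * S) = 2^-1; last by [].
  by rewrite /tau; field; rewrite gt_eqF.
- by rewrite sort_uniq iota_uniq.
- rewrite -sorted_pairwise; last by move=> i j k /= ji ik; apply: le_trans ik ji.
  apply: sort_sorted => i j; rewrite /ge; apply: real_leVge; exact/ger0_real/psd_diag.
- by move=> k; rewrite (perm_big _ Lp) /= big_mkord.
exists q; split.
  have WP : psd (fun z w => \prod_(m <- L) damp tau (a m) z w * s z w).
    apply: psd_mul pick_kernel_psd; apply: psd_prod => j.
    by apply: damp_psd; [exact: ltW|rewrite gt_eqF].
  apply: (eq_psd _ (psd_add qP WP)) => z w.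
  rewrite [X in _ - X * _](perm_big _ Lp) /= big_mkord.
  by move: (\prod_(m <- L) _) => W; ring.
move=> k kn; have -> : (8 * S)^-1 = tau / 2 by rewrite /tau; field; rewrite gt_eqF.
by apply: qk; rewrite mem_sort mem_iota.
Qed.

End Row.

(** * Means on bounded sequences *)

Section Mean.
Local Open Scope classical_set_scope.
Variable R : realType.
Local Notation C := R[i].

Lemma Re_norm_le (z : C) : `|complex.Re z| <= complex.Re `|z|.
Proof. by rewrite normc_def /= -sqrtr_sqr ler_wsqrtr // lerDl sqr_ge0. Qed.

Lemma Im_norm_le (z : C) : `|complex.Im z| <= complex.Re `|z|.
Proof. by rewrite normc_def /= -sqrtr_sqr ler_wsqrtr // lerDr sqr_ge0. Qed.

Lemma ultra_bounded_cvg (U : set_system nat) (x : nat -> R) (M : R) :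
  UltraFilter U -> (forall n, `|x n| <= M) -> cvg (x n @[n --> U]).
Proof.
move=> UU xM; have UP : ProperFilter U by exact: ultra_proper.
have xS : U (x @^-1` `[- M, M]%classic).
  by apply: filterE => n /=; rewrite in_itv /= -ler_norml.
have [p [_ px]] := segment_compact (fmap_proper_filter x UP) xS.
apply/cvg_ex; exists p => V Vp.
have [//|Vn] := in_ultra_setVsetC (x @^-1` V) UU.
by have [t [nVt /nVt]] := px (~` V) V Vn Vp.
Qed.

Lemma banach_mean : exists L : (nat -> C) -> C,
  [/\ forall (a : C) u v, linf u -> linf v -> L (fun n => a * u n + v n) = a * L u + L v,
      forall u M, linf_bound u M -> `|L u| <= M
    & forall u c N, linf u -> (forall n, (N <= n)%N -> u n = c) -> L u = c].
Proof.
have [U [UU Uoo]] := ultraFilterLemma (F := \oo) _.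
have UP : ProperFilter U by exact: ultra_proper.
pose l (x : nat -> R) : R := lim (x n @[n --> U]).
pose bd (x : nat -> R) := exists M : R, forall n, `|x n| <= M.
have lP x : bd x -> x n @[n --> U] --> l x.
  by move=> [M xM]; exact: (ultra_bounded_cvg UU xM).
have lD x y : bd x -> bd y -> l (fun n => x n + y n) = l x + l y.
  move=> /lP xl /lP yl; apply: cvg_lim => //; exact: cvgD.
have lM (a : R) x : bd x -> l (fun n => a * x n) = a * l x.
  by move=> /lP xl; apply: cvg_lim => //; apply: cvgM => //; exact: cvg_cst.
have bM (a : R) x : bd x -> bd (fun n => a * x n).
  move=> [M xM]; exists (`|a| * M) => n; rewrite normrM; exact: ler_wpM2l.
have bD x y : bd x -> bd y -> bd (fun n => x n + y n).
  move=> [M xM] [N yN]; exists (M + N) => n; apply: le_trans (ler_normD _ _) _; exact: lerD.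
have linfP (u : nat -> C) : linf u -> bd (fun n => complex.Re (u n)) /\ bd (fun n => complex.Im (u n)).
  move=> [M [M0 uM]]; split; exists (complex.Re M) => n; have := uM n;
    rewrite lecE => /andP[_]; apply: le_trans; [exact: Re_norm_le|exact: Im_norm_le].
pose L (u : nat -> C) : C := (l (fun n => complex.Re (u n)) +i* l (fun n => complex.Im (u n)))%C.
have Llin (a : C) u v : linf u -> linf v -> L (fun n => a * u n + v n) = a * L u + L v.
  move=> /linfP[ur ui] /linfP[vr vi]; rewrite /L; case: a => [a b].
  have -> : (fun n => complex.Re ((a +i* b)%C * u n + v n)) =
     (fun n => (a * complex.Re (u n) + (- b) * complex.Im (u n)) + complex.Re (v n)).
    by apply/funext => n; case: (u n) => [? ?]; case: (v n) => [? ?] /=; rewrite mulNr.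
  have -> : (fun n => complex.Im ((a +i* b)%C * u n + v n)) =
     (fun n => (a * complex.Im (u n) + b * complex.Re (u n)) + complex.Im (v n)).
    by apply/funext => n; case: (u n) => [? ?]; case: (v n) => [? ?].
  rewrite !lD ?lM //; try by [apply: bM | apply: bD; apply: bM].
  by apply/eqP; rewrite eq_complex /= mulNr !eqxx.
exists L; split=> //.
- move=> u M [M0 uM].
  have [->|Lnz] := eqVneq (L u) 0; first by rewrite normr0.
  have nu : 0 < `|L u| by rewrite normr_gt0.
  pose th := (L u)^* / `|L u|.
  have th1 : `|th| = 1 by rewrite normrM normfV normr_id norm_conjC mulfV ?gt_eqF.
  have e : L (fun n => th * u n + 0) = `|L u|.
    rewrite Llin; [|by exists M|by exists 0; split=> // n; rewrite normr0].
    have -> : L (fun=> 0) = 0.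
      by rewrite /L /l !lim_cst.
    by rewrite addr0 /th mulrAC mulrC -[_ * L u]mulrC -normCK expr2 mulKf ?gt_eqF.
  rewrite -e.
  have : 0 <= L (fun n => th * u n + 0) by rewrite e ltW.
  rewrite lecE /= => /andP[/eqP im0 re0].
  case: M M0 uM => [M M'] M0 uM.
  have M'0 : M' = 0 by move: M0; rewrite lecE /= => /andP[/eqP].
  rewrite lecE /= im0 M'0 eqxx /=.
  have bu : linf (fun n => th * u n + 0).
    exists (M +i* M')%C; split=> // n; rewrite addr0 normrM th1 mul1r; exact: uM.
  have [br _] := linfP _ bu.
  apply: limr_le; first by have := lP _ br; move=> h; apply/cvg_ex; eexists; exact: h.
  near=> n; have := uM n; rewrite M'0 => h.
  have : `|th * u n + 0| <= (M +i* 0)%C by rewrite addr0 normrM th1 mul1r.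
  rewrite lecE => /andP[_]; apply: le_trans.
  apply: le_trans (ler_norm _) _; exact: Re_norm_le.
- move=> u c N bu uc; have [br bi] := linfP _ bu.
  suff cst (x : nat -> R) d : (forall n, (N <= n)%N -> x n = d) -> l x = d.
    rewrite /L; have -> : l (fun n => complex.Re (u n)) = complex.Re c by apply: cst => n /uc->.
    have -> : l (fun n => complex.Im (u n)) = complex.Im c by apply: cst => n /uc->.
    by case: (c).
  move=> xd; apply: cvg_lim => //; apply: (@cvg_trans _ (d @[_ --> U])); last exact: cvg_cst.
  apply: near_eq_cvg; apply: Uoo; exists N => // n /= Nn.
  by rewrite xd.
Unshelve. all: by end_near.
Qed.

End Mean.

(** * Sufficiency *)

Section Forward.
Variable R : realType.
Local Notation C := R[i].

Lemma pick_extension_fin (I : finType) (Y : Type) (B g : Y -> Y -> C) (y : I -> Y)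
    (f : I -> C) :
  psd B -> (forall x, B x x < 1) -> psd g ->
  (forall c : I -> C,
     let e := \sum_i \sum_j (c i)^* * c j *
       ((1 - B (y i) (y j))^-1 * (g (y i) (y j) - f i * (f j)^*)) in
     0 <= e /\ (e = 0 -> forall i, c i = 0)) ->
  exists phi : Y -> C, (forall i, phi (y i) = f i) /\
    psd (fun z w => (1 - B z w)^-1 * (g z w - phi z * (phi w)^*)).
Proof.
move=> BP B1 gP h.
have sE (F : I -> C) : \sum_i F i = \sum_(e < #|I|) F (enum_val e).
  by rewrite (reindex (fun e : 'I_#|I| => enum_val e)) //; apply: onW_bij; exact: enum_val_bij.
have [|phi [phif phiP]] := @pick_extension R Y B g #|I| (y \o enum_val) (f \o enum_val) BP B1 gP.
  move=> c e; have [e0 e1] := h (c \o enum_rank).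
  suff eE : e = \sum_i \sum_j (c (enum_rank i))^* * c (enum_rank j) *
       ((1 - B (y i) (y j))^-1 * (g (y i) (y j) - f i * (f j)^*)).
    by rewrite eE; split=> // /e1 ci i; have := ci (enum_val i); rewrite /= enum_valK.
  rewrite /e sE; apply: eq_bigr => i _; rewrite sE; apply: eq_bigr => j _.
  by rewrite /= !enum_valK.
by exists phi; split=> // i; rewrite -(enum_rankK i) phif.
Qed.

Lemma psd_delta (Y : Type) (J : eqType) (p : Y -> J) :
  psd (fun y z : Y => (p y == p z)%:R : C).
Proof.
apply: (psd_pullback p (k := fun i j : J => (i == j)%:R)) => s.
rewrite /combo_norm2; pose L := undup [seq p.2 | p <- s].
have : 0 <= \sum_(i <- L) (\sum_(p <- s | p.2 == i) p.1) * (\sum_(p <- s | p.2 == i) p.1)^*.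
  by apply: sumr_ge0 => i _; rewrite mul_conjC_ge0.
congr (0 <= _).
have -> : \sum_(q <- s) \sum_(q0 <- s) (q.1)^* * q0.1 * (q.2 == q0.2)%:R =
  \sum_(q <- s) \sum_(i <- L) (i == q.2)%:R * ((q.1)^* * \sum_(p <- s | p.2 == i) p.1).
  rewrite !big_seq; apply: eq_bigr => q qs.
  have qL : q.2 \in L by rewrite mem_undup map_f.
  rewrite (bigD1_seq q.2) ?undup_uniq //= eqxx mul1r.
  rewrite [X in _ = _ + X]big1 ?addr0; last by move=> i /negPf iq; rewrite iq mul0r.
  rewrite mulr_sumr [RHS]big_mkcond; apply: eq_bigr => q' _.
  by rewrite eq_sym; case: eqP; rewrite ?mulr1 ?mulr0.
rewrite exchange_big /=; apply: eq_bigr => i _.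
rewrite rmorph_sum mulrC mulr_suml [LHS]big_mkcond; apply: eq_bigr => q _.
by rewrite eq_sym; case: eqP; rewrite ?mul1r ?mul0r.
Qed.

Variables (X : Type) (B l g : X -> X -> C) (lam : nat -> X).
Hypotheses (BP : psd B) (B1 : forall x, B x x < 1) (gP : psd g).
Local Notation s := (pick_kernel B).
Hypothesis lE : forall z w, l z w = s z w * g z w.
Hypothesis l0 : forall z, 0 < l z z.

Let sP : psd s. Proof. exact: pick_kernel_psd. Qed.
Let lP : psd l. Proof. by apply: (eq_psd _ (psd_mul sP gP)) => z w. Qed.
Let s0 z : 0 < s z z. Proof. by rewrite invr_gt0 subr_gt0. Qed.
Let kn0 (k : X -> X -> C) z : 0 < k z z -> 0 < knorm k z. Proof. by move=> ?; rewrite sqrtC_gt0. Qed.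

Lemma knormK (k : X -> X -> C) z : knorm k z ^+ 2 = k z z.
Proof. exact: sqrtCK. Qed.

Section Finite.
Variables (K eps : C).
Hypotheses (K0 : 0 < K) (eps0 : 0 < eps).
Hypothesis carl : forall f c, rkhs_bound s f c -> forall N,
  \sum_(i < N) `|f (lam i)| ^+ 2 / knorm s (lam i) ^+ 2 <= K * c ^+ 2.
Hypothesis ss : forall i (cs : seq (C * nat)), all (fun p => p.2 != i) cs ->
  eps ^+ 2 <= combo_norm2 l (((knorm l (lam i))^-1, lam i)
           :: [seq (- p.1 / knorm l (lam p.2), lam p.2) | p <- cs]).

Lemma carleson_row (n k : nat) :
  \sum_(m < n) (1 - B (lam m) (lam m)) * (1 - B (lam k) (lam k)) * `|s (lam m) (lam k)| ^+ 2 <= K.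
Proof.
have := carl (rkhs_bound_combo sP [:: (1, lam k)]) n.
rewrite sqrtCK /combo_norm2 !big_seq1 /= conjC1 !mul1r => h.
rewrite -[K]mulr1 -(mulVf (lt0r_neq0 (s0 (lam k)))) [_ * s _ _]mulrC mulrA.
rewrite ler_pdivlMr; last by rewrite invr_gt0 subr_gt0.
apply: le_trans h; rewrite mulr_suml le_eqVlt; apply/orP; left; apply/eqP.
apply: eq_bigr => i _; rewrite big_seq1 mul1r knormK.
have nk := pick_kernel_sub_neq0 BP B1 (lam k) (lam k).
have ni := pick_kernel_sub_neq0 BP B1 (lam i) (lam i).
by move: (`|_|) => u; rewrite /pick_kernel; field; rewrite nk ni.
Qed.

Lemma carleson_gram (n : nat) (c : nat -> C) :
  \sum_(i < n) \sum_(j < n) (c i)^* * c j * s (lam i) (lam j) <=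
  K * \sum_(i < n) `|c i| ^+ 2 * s (lam i) (lam i).
Proof.
pose t := [seq (c i, lam i) | i <- index_iota 0 n].
have := carl (rkhs_bound_combo sP t) n; rewrite sqrtCK.
have -> : combo_norm2 s t = \sum_(i < n) \sum_(j < n) (c i)^* * c j * s (lam i) (lam j).
  by rewrite /combo_norm2 big_map big_mkord; apply: eq_bigr => i _; rewrite big_map big_mkord.
set N := \sum_(i < n) \sum_(j < n) _.
pose f x := \sum_(j < n) c j * s x (lam j).
under eq_bigr do rewrite big_map big_mkord -/(f _) knormK.
have N0 : 0 <= N by exact: (psd_form (index_enum 'I_n) (fun i : 'I_n => c i) (fun i : 'I_n => lam i) sP).
have NE : N = \sum_(i < n) (c i)^* * f (lam i).
  by apply: eq_bigr => i _; rewrite mulr_sumr; apply: eq_bigr => j _; rewrite mulrA.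
have NE' : N = \sum_(i < n) c i * (f (lam i))^*.
  by rewrite -(ge0_conj N0) NE rmorph_sum; apply: eq_bigr => i _; rewrite rmorphM /= conjCK.
move=> h; rewrite -(lerD2r N).
apply: (@le_trans _ _ (K * (\sum_(i < n) `|c i| ^+ 2 * s (lam i) (lam i)) +
   K^-1 * \sum_(i < n) `|f (lam i)| ^+ 2 / s (lam i) (lam i))); last first.
  by rewrite lerD2l mulrC ler_pdivrMr // mulrC.
rewrite {1}NE NE' -big_split !mulr_sumr -big_split; apply: ler_sum => i _ /=.
have si := s0 (lam i); set S := s _ _ in si *.
have p0 : 0 < K * S by rewrite mulr_gt0.
rewrite -subr_ge0.
have -> : K * (`|c i| ^+ 2 * S) + K^-1 * (`|f (lam i)| ^+ 2 / S) -
   ((c i)^* * f (lam i) + c i * (f (lam i))^*) =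
   (K * S) * ((c i - f (lam i) / (K * S)) * (c i - f (lam i) / (K * S))^*).
  rewrite rmorphB rmorphM fmorphV /= (ge0_conj (ltW p0)) !normCK.
  by field; rewrite !gt_eqF.
by rewrite mulr_ge0 ?(ltW p0) // mul_conjC_ge0.
Qed.

Lemma separation_gram (n k : nat) (c : nat -> C) : (k < n)%N ->
  eps ^+ 2 * (`|c k| ^+ 2 * l (lam k) (lam k)) <=
  \sum_(i < n) \sum_(j < n) (c i)^* * c j * l (lam i) (lam j).
Proof.
move=> kn; have [->|cn] := eqVneq (c k) 0.
  rewrite normr0 expr0n mul0r mulr0.
  exact: (psd_form (index_enum 'I_n) (fun i : 'I_n => c i) (fun i : 'I_n => lam i) lP).
pose nu i := knorm l (lam i).
have nup i : 0 < nu i by exact: kn0.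
have nun i : nu i != 0 by rewrite gt_eqF.
pose d := c k * nu k; have dn : d != 0 by rewrite mulf_neq0.
pose r := [seq j <- iota 0 n | j != k].
have [kr krE] : exists kr, kr = k :: r by eexists.
have rp : perm_eq kr (index_iota 0 n).
  rewrite krE /r -rem_filter ?iota_uniq // perm_sym /index_iota subn0.
  by apply: perm_to_rem; rewrite mem_iota.
have /ss : all (fun p : C * nat => p.2 != k) [seq (- (c j * nu j) / d, j) | j <- r].
  by apply/allP => p /mapP[j]; rewrite mem_filter => /andP[jk _] ->.
have -> : ((knorm l (lam k))^-1, lam k) :: [seq (- p.1 / knorm l (lam p.2), lam p.2)
    | p <- [seq (- (c j * nu j) / d, j) | j <- r]] = [seq (c j / d, lam j) | j <- kr].
  rewrite krE /= -map_comp; congr (_ :: _).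
    by rewrite /d invfM mulVKf.
  apply: eq_map => j /=; congr (_, _); rewrite -/(nu j); field.
  by rewrite dn nun.
rewrite /combo_norm2 big_map (perm_big _ rp) big_mkord /=.
under eq_bigr do rewrite big_map (perm_big _ rp) big_mkord /=.
have -> : `|c k| ^+ 2 * l (lam k) (lam k) = d * d^*.
  by rewrite -knormK -/(nu k) normCK /d rmorphM /= (ge0_conj (ltW (nup k))); ring.
have dd : 0 < d * d^* by rewrite lt_def mul_conjC_ge0 mulf_neq0 ?conjC_eq0.
move=> h; rewrite -ler_pdivlMr //; apply: le_trans h _.
rewrite mulr_suml le_eqVlt; apply/orP; left; apply/eqP.
apply: eq_bigr => i _; rewrite mulr_suml; apply: eq_bigr => j _.
by rewrite rmorphM fmorphV /=; field; rewrite conjC_eq0 dn.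
Qed.

Let t i := knorm l (lam i) / knorm s (lam i).

Lemma column_multiplier (n : nat) : exists phi : nat -> X -> C,
  (forall i k, (i < n)%N -> (k < n)%N -> phi k (lam i) = (i == k)%:R * t i) /\
  psd (fun y z : X * nat =>
    2 * K / eps ^+ 2 * (l y.1 z.1 * (y.2 == z.2)%:R) - phi y.2 y.1 * (phi z.2 z.1)^* * s y.1 z.1).
Proof.
set K2 := 2 * K / eps ^+ 2.
have K20 : 0 < K2 by rewrite divr_gt0 ?mulr_gt0 ?exprn_gt0.
pose B' (y z : X * nat) := B y.1 z.1.
pose g' (y z : X * nat) := K2 * (g y.1 z.1 * (y.2 == z.2)%:R).
have B'P : psd B' by exact: (psd_pullback fst BP).
have g'P : psd g'.
  by apply: psd_scale (ltW K20) _; apply: psd_mul (psd_pullback fst gP) (psd_delta snd).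
have [|phi [phif phiP]] := @pick_extension_fin ('I_n * 'I_n)%type (X * nat) B' g'
   (fun p => (lam p.1, nat_of_ord p.2)) (fun p => (p.1 == p.2)%:R * t p.1) B'P (fun x => B1 x.1) g'P.
  move=> x e.
  pose F k := \sum_(i < n) \sum_(j < n) (x (i, k))^* * x (j, k) * l (lam i) (lam j).
  pose G := \sum_(i < n) \sum_(j < n) (x (i, i) * t i)^* * (x (j, j) * t j) * s (lam i) (lam j).
  have tc i : (t i)^* = t i.
    by rewrite ge0_conj // /t divr_ge0 // ltW // kn0.
  have eE : e = K2 * \sum_k F k - G.
    rewrite /e; transitivity (\sum_(i < n) \sum_(k < n) \sum_(j < n) \sum_(m < n)
      ((x (i, k))^* * x (j, m) * (K2 * (l (lam i) (lam j) * (k == m)%:R)) -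
       (x (i, k))^* * x (j, m) * ((i == k)%:R * t i * ((j == m)%:R * t j) * s (lam i) (lam j)))).
      rewrite [RHS]pair_bigA /=; apply: eq_bigr => -[i k] _.
      rewrite [RHS]pair_bigA /=; apply: eq_bigr => -[j m] _ /=.
      rewrite -mulrBr; congr (_ * _).
      rewrite /B' /g' /= lE rmorphM /= conjC_nat tc -/(s (lam i) (lam j)); ring.
    rewrite /G mulr_sumr.
    have -> : \sum_k K2 * F k = \sum_(i < n) \sum_(k < n) \sum_(j < n)
       (x (i, k))^* * x (j, k) * (K2 * l (lam i) (lam j)).
      rewrite exchange_big /=; apply: eq_bigr => k _; rewrite mulr_sumr; apply: eq_bigr => i _.
      by rewrite mulr_sumr; apply: eq_bigr => j _; ring.
    rewrite -sumrB; apply: eq_bigr => i _.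
    transitivity (\sum_(k < n) (\sum_(j < n) (x (i, k))^* * x (j, k) * (K2 * l (lam i) (lam j)) -
      (i == k)%:R * \sum_(j < n) (x (i, k))^* * x (j, j) * (t i * t j * s (lam i) (lam j)))).
      apply: eq_bigr => k _; rewrite mulr_sumr -sumrB; apply: eq_bigr => j _.
      rewrite sumrB; congr (_ - _).
        rewrite (bigD1 k) //= big1 ?addr0 => [|m /negPf]; first by rewrite eqxx mulr1.
        by rewrite eq_sym => ->; rewrite !mulr0.
      rewrite (bigD1 j) //= big1 ?addr0 => [|m /negPf]; first by rewrite eqxx mul1r; ring.
      by rewrite eq_sym => ->; rewrite mul0r !(mulr0, mul0r).
    rewrite sumrB; congr (_ - _).
    rewrite (bigD1 i) //= [X in _ + X = _]big1 ?addr0 => [|m /negPf]; last first.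
      by rewrite eq_sym => ->; rewrite mul0r.
    rewrite eqxx mul1r; apply: eq_bigr => j _; rewrite rmorphM /= tc; ring.
  have Fge k i : eps ^+ 2 * (`|x (i, k)| ^+ 2 * l (lam i) (lam i)) <= F k.
    pose c j := if insub j is Some j' then x (j', k) else 0.
    have cE (j : 'I_n) : c j = x (j, k).
      by rewrite /c insubT //= => jn; congr (x (_, _)); apply: val_inj.
    have := separation_gram c (ltn_ord i); rewrite cE; move/le_trans; apply.
    rewrite le_eqVlt; apply/orP; left; apply/eqP.
    by apply: eq_bigr => a _; apply: eq_bigr => b _; rewrite !cE.
  have F0 k : 0 <= F k.
    exact: (psd_form (index_enum 'I_n) (fun i => x (i, k)) (fun i : 'I_n => lam i) lP).
  have GF : G <= K / eps ^+ 2 * \sum_k F k.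
    pose c j := if insub j is Some j' then x (j', j') * t j else 0.
    have cE (j : 'I_n) : c j = x (j, j) * t j.
      rewrite /c insubT //= => jn; congr (x (_, _) * _); exact: val_inj.
    have := carleson_gram n c.
    under eq_bigr do under eq_bigr do rewrite !cE.
    move/le_trans; apply; rewrite -mulrA; apply: ler_wpM2l; first exact: ltW.
    rewrite mulrC ler_pdivlMr ?exprn_gt0 // mulr_suml; apply: ler_sum => i _.
    apply: le_trans (Fge i i); rewrite cE le_eqVlt; apply/orP; left; apply/eqP.
    rewrite mulrC; congr (_ * _); rewrite normrM exprMn -mulrA; congr (_ * _).
    rewrite /t ger0_norm; last by rewrite divr_ge0 // ltW // kn0.
    by rewrite expr_div_n !knormK divfK // gt_eqF.
  have ege : K / eps ^+ 2 * \sum_k F k <= e.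
    rewrite eE lerBrDr; apply: le_trans (lerD (lexx _) GF) _.
    by rewrite le_eqVlt; apply/orP; left; apply/eqP; rewrite /K2; ring.
  have Ke : 0 < K / eps ^+ 2 by rewrite divr_gt0 ?exprn_gt0.
  have sF0 : 0 <= \sum_k F k by exact: sumr_ge0.
  split; first by apply: le_trans ege; rewrite mulr_ge0 // ltW.
  move=> e0 [i k]; move: ege; rewrite e0 pmulr_rle0 // => sF.
  have /eqP : \sum_k F k = 0 by apply/eqP; rewrite eq_le sF sF0.
  rewrite psumr_eq0 // => /allP/(_ k (mem_index_enum _)) /eqP Fk.
  have := Fge k i; rewrite Fk pmulr_rle0 ?exprn_gt0 // pmulr_lle0 // => x0.
  apply/eqP; rewrite -normr_eq0 -sqrf_eq0 eq_le x0 /=; exact: exprn_ge0.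
exists (fun k x => phi (x, k)); split.
  by move=> i k ilt klt; have := phif (Ordinal ilt, Ordinal klt).
apply: (eq_psd _ phiP) => -[x i] [z j] /=.
by rewrite /B' /g' /= lE /pick_kernel; ring.
Qed.

Lemma finite_interpolation (n : nat) : exists T : (nat -> C) -> X -> C,
  [/\ forall (a : C) w v x, T (fun i => a * w i + v i) x = a * T w x + T v x,
      forall w M, linf_bound w M -> mult_bound s l (T w) (sqrtC (2 * K / eps ^+ 2 * (8 * K)) * M)
    & forall w j, (j < n)%N -> T w (lam j) = w j * knorm l (lam j) / knorm s (lam j)].
Proof.
set K2 := 2 * K / eps ^+ 2.
have K20 : 0 < K2 by rewrite divr_gt0 ?mulr_gt0 ?exprn_gt0.
have K8 : 0 < 8 * K by rewrite mulr_gt0.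
have [phi [phi_node phiP]] := column_multiplier n.
have [q [qP q_node]] := row_multiplier BP B1 K0 (carleson_row n).
have qn k : (k < n)%N -> q k (lam k) != 0.
  move=> /q_node h; apply/negP => /eqP q0; move: h.
  by rewrite q0 normr0 expr0n /= lt_geF // invr_gt0.
exists (fun w z => \sum_(k < n) w k / q k (lam k) * q k z * phi k z); split.
- move=> a w v x; rewrite mulr_sumr -big_split; apply: eq_bigr => k _ /=; ring.
- move=> w M [M0 wM]; apply/(mult_boundP sP lP); split.
    by apply: mulr_ge0 => //; rewrite sqrtC_ge0 mulr_ge0 // ltW.
  rewrite exprMn sqrtCK.
  pose v k := w k / q k (lam k).
  have vM (k : 'I_n) : 0 <= 8 * K * M ^+ 2 - v k * (v k)^*.
    rewrite subr_ge0 -normCK normrM normfV exprMn exprVn mulrC.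
    apply: ler_pM; rewrite ?invr_ge0 ?exprn_ge0 //; last by rewrite lerXn2r ?nnegrE.
    rewrite -[8 * K]invrK lef_pV2 ?posrE ?q_node ?exprn_gt0 ?normr_gt0 ?qn ?invr_gt0 //.
  have P1 := psd_pullback (fun z => [seq ((v k * q k z)^*, (z, k)) | k <- index_iota 0 n])
    (psd_combo phiP).
  have P2 : psd (fun z x => \sum_(k < n) K2 * ((8 * K * M ^+ 2 - v k * (v k)^*) *
     (q k z * (q k x)^* * l z x))).
    apply: psd_sum => k; apply: psd_scale (ltW K20) _; apply: psd_scale (vM k) _.
    exact: psd_rank1_mul.
  have K3 : 0 <= K2 * (8 * K * M ^+ 2) 
    by apply: (mulr_ge0 (ltW K20)); apply: (mulr_ge0 (ltW K8)); apply: exprn_ge0.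
  have P3 := psd_scale K3 (psd_mul qP gP).
  apply: (eq_psd _ (psd_add P1 (psd_add P2 P3))) => z x.
  rewrite big_map big_mkord -!/(v _) /=.
  have -> : \sum_(k < n) \sum_(p <- [seq ((v j * q j x)^*, (x, j)) | j <- index_iota 0 n])
      (v k * q k z)^*^* * p.1 * (K2 * (l z p.2.1 * (nat_of_ord k == p.2.2)%:R) -
         phi k z * (phi p.2.2 p.2.1)^* * s z p.2.1) =
    K2 * l z x * (\sum_(k < n) v k * (v k)^* * (q k z * (q k x)^*)) -
    (\sum_(k < n) v k * q k z * phi k z) * (\sum_(k < n) v k * q k x * phi k x)^* * s z x.
    rewrite mulr_sumr rmorph_sum !mulr_suml -sumrB; apply: eq_bigr => k _.
    rewrite big_map big_mkord mulr_sumr mulr_suml conjCK.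
    transitivity (\sum_(j < n) ((k == j)%:R * (K2 * l z x * (v k * (v j)^* * (q k z * (q j x)^*)))
       - v k * q k z * phi k z * (v j * q j x * phi j x)^* * s z x)).
      by apply: eq_bigr => j _ /=; rewrite -(inj_eq val_inj) !rmorphM /=; ring.
    rewrite sumrB; congr (_ - _); rewrite (bigD1 k) //= eqxx mul1r big1 ?addr0 // => j /negPf.
    by rewrite eq_sym => ->; rewrite mul0r.
  have -> : \sum_(k < n) K2 * ((8 * K * M ^+ 2 - v k * (v k)^*) * (q k z * (q k x)^* * l z x)) =
    K2 * l z x * ((8 * K * M ^+ 2) * \sum_(k < n) q k z * (q k x)^* -
       \sum_(k < n) v k * (v k)^* * (q k z * (q k x)^*)).
    rewrite [_ * (_ ^+ 2) * _]mulr_sumr -sumrB mulr_sumr; apply: eq_bigr => k _; ring.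
  by rewrite lE; ring.
- move=> w j jn; rewrite (bigD1 (Ordinal jn)) //= big1 ?addr0 => [|k].
    by rewrite phi_node // eqxx mul1r divfK ?qn // mulrA.
  rewrite -(inj_eq val_inj) /= eq_sym => /negPf kj.
  by rewrite phi_node // kj mul0r mulr0.
Qed.

End Finite.

Lemma carleson_separated_interpolation :
  carleson s lam -> strongly_separated l lam ->
  exists T : (nat -> C) -> (X -> C),
    [/\ forall (a : C) (w v : nat -> C), linf w -> linf v ->
          T (fun i => a * w i + v i) = (fun x => a * T w x + T v x),
        exists K : C, 0 <= K /\
          forall w M, linf_bound w M -> mult_bound s l (T w) (K * M)
      & forall w, linf w -> forall j,
          T w (lam j) = w j * knorm l (lam j) / knorm s (lam j)].
Proof.
move=> [K [K0 carl]] [eps [eps0 ss]].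
have /choice[T TP] := finite_interpolation K0 eps0 carl ss.
have [L [Llin Lnorm Lcst]] := @banach_mean R.
set K3 := sqrtC _ in TP.
have K30 : 0 <= K3 by rewrite sqrtC_ge0 !mulr_ge0 ?invr_ge0 ?exprn_ge0 // ltW.
have Tbd w x : linf w -> linf (fun n => T n w x).
  move=> [M wM]; have [M0 _] := wM.
  exists (K3 * M * knorm l x / knorm s x); split=> [|n].
    by rewrite divr_ge0 ?mulr_ge0 // ltW // kn0.
  have [_ /(_ _ _ wM)/(mult_boundP sP lP)[KM /(psd_diag x) h] _] := TP n.
  rewrite subr_ge0 -normCK in h.
  rewrite -(@ler_pXn2r _ 2) ?nnegrE ?divr_ge0 ?mulr_ge0 ?(ltW (kn0 _)) //.
  by rewrite expr_div_n !exprMn !knormK ler_pdivlMr // -exprMn.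
exists (fun w x => L (fun n => T n w x)); split.
- move=> a w v wb vb; apply/funext => x; rewrite -Llin; try exact: Tbd.
  by congr L; apply/funext => n; have [-> _ _] := TP n.
- exists K3; split=> // w M wM; have [M0 _] := wM.
  split=> [|f c fc]; first by rewrite mulr_ge0.
  have [c0 _] := fc; split=> [|u]; first by rewrite !mulr_ge0.
  have wb : linf w by exists M.
  have [Lu Lb] : \sum_(q <- u) (q.1)^* * (L (fun n => T n w q.2) * f q.2) =
      L (fun n => \sum_(q <- u) (q.1)^* * (T n w q.2 * f q.2)) /\
      linf (fun n => \sum_(q <- u) (q.1)^* * (T n w q.2 * f q.2)).
    elim: u => [|q u [IH1 IH2]].
      have z0 : linf (fun n : nat => \sum_(q <- ([::] : seq (C * X))) (q.1)^* * (T n w q.2 * f q.2)).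
        by exists 0; split=> // n; rewrite big_nil normr0.
      split=> //; rewrite big_nil; apply/esym; apply: (Lcst _ _ 0%N z0) => n _; exact: big_nil.
    have e : (fun n => \sum_(q0 <- q :: u) (q0.1)^* * (T n w q0.2 * f q0.2)) =
       (fun n => ((q.1)^* * f q.2) * T n w q.2 + \sum_(q <- u) (q.1)^* * (T n w q.2 * f q.2)).
      by apply/funext => n; rewrite big_cons; congr (_ + _); ring.
    rewrite e Llin //; last exact: Tbd.
    rewrite big_cons IH1; split; first by congr (_ + _); ring.
    have [M1 [M10 h1]] := Tbd w q.2 wb; have [M2 [M20 h2]] := IH2.
    exists (`|(q.1)^* * f q.2| * M1 + M2); split=> [|n]; first by rewrite addr_ge0 ?mulr_ge0.
    apply: le_trans (ler_normD _ _) _; apply: lerD => //.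
    by rewrite normrM; apply: ler_wpM2l.
  rewrite Lu.
  have B0 : 0 <= (K3 * M * c) ^+ 2 * combo_norm2 l u by rewrite mulr_ge0 ?lP // exprn_ge0 // !mulr_ge0.
  rewrite -(sqrtCK (_ * combo_norm2 l u)) lerXn2r ?nnegrE ?sqrtC_ge0 //.
  apply: Lnorm; split=> [|n]; first by rewrite sqrtC_ge0.
  have [_ /(_ _ _ wM) [_ /(_ _ _ fc) [_ /(_ u) h]] _] := TP n.
  by rewrite -(@ler_pXn2r _ 2) ?nnegrE ?sqrtC_ge0 // sqrtCK.
- move=> w wb j; apply: (Lcst _ _ j.+1); first exact: Tbd.
  by move=> n jn; have [_ _ ->] := TP n.
Qed.

End Forward.

(** * Necessity *)

Section Converse.
Variable R : realType.
Local Notation C := R[i].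

Lemma psd_nat (k : nat -> nat -> C) :
  (forall n (c : nat -> C), 0 <= \sum_(i < n) \sum_(j < n) (c i)^* * c j * k i j) -> psd k.
Proof.
move=> kP s; pose N := \max_(q <- s) q.2.
have kP' : psd (fun i j : 'I_N.+1 => k i j).
  apply: psd_fin => c; have := kP N.+1 (fun i => c (inord i)).
  by under eq_bigr do under eq_bigr do rewrite !inord_val.
have := psd_pullback (fun i : nat => inord i : 'I_N.+1) kP' s; congr (0 <= _).
rewrite /combo_norm2 !big_seq; apply: eq_bigr => p ps.
rewrite !big_seq; apply: eq_bigr => q qs.
by rewrite !inordK // ltnS /N; apply: leq_bigmax_seq.
Qed.

Definition form (k : nat -> nat -> C) (n : nat) (c : nat -> C) : C :=
  \sum_(i < n) \sum_(j < n) (c i)^* * c j * k i j.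

Lemma form_ge0 k n c : psd k -> 0 <= form k n c.
Proof. exact: (psd_form (index_enum 'I_n) (fun i : 'I_n => c i) (@nat_of_ord n)). Qed.

Lemma eq_form k n c d : (forall i, (i < n)%N -> c i = d i) -> form k n c = form k n d.
Proof. by move=> e; apply: eq_bigr => i _; apply: eq_bigr => j _; rewrite !e. Qed.

Lemma form_add_le k n c d : psd k ->
  form k n (fun i => c i + d i) <= 2 * form k n c + 2 * form k n d.
Proof.
move=> kP; rewrite -subr_ge0; have := form_ge0 n (fun i => c i - d i) kP; congr (0 <= _).
rewrite /form !mulr_sumr -big_split -sumrB; apply: eq_bigr => i _.
rewrite !mulr_sumr -big_split -sumrB; apply: eq_bigr => j _ /=.
by rewrite rmorphB rmorphD /=; ring.
Qed.

Lemma form_single k n c m : (m < n)%N -> (forall i, i != m -> c i = 0) ->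
  form k n c = `|c m| ^+ 2 * k m m.
Proof.
move=> mn c0; pose m' := Ordinal mn.
rewrite /form (bigD1 m') //= [X in _ + X]big1 => [|i im]; last first.
  move: im; rewrite -(inj_eq val_inj) => /= im.
  by rewrite big1 // => j _; rewrite (c0 i) // conjC0 !mul0r.
rewrite addr0 (bigD1 m') //= big1 ?addr0 => [|i im]; first by rewrite normCK [c m * _]mulrC.
by move: im; rewrite -(inj_eq val_inj) => /= im; rewrite (c0 i) // mulr0 mul0r.
Qed.

Lemma form_recr k n c : (forall i j, k j i = (k i j)^*) ->
  form k n.+1 c = form k n c + ((\sum_(i < n) (c i)^* * c n * k i n) +
     (\sum_(i < n) (c i)^* * c n * k i n)^*) + `|c n| ^+ 2 * k n n.
Proof.
move=> kH; rewrite /form big_ord_recr /=; under eq_bigr do rewrite big_ord_recr /=.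
rewrite big_split big_ord_recr /= normCK [c n * _]mulrC -!addrA; congr (_ + (_ + (_ + _))).
rewrite rmorph_sum; apply: eq_bigr => i _.
by rewrite !rmorphM /= conjCK -kH; ring.
Qed.

Definition sgc (b : bool) : C := if b then 1 else -1.

Lemma sgc2 b : sgc b * sgc b = 1. Proof. by case: b; rewrite /= ?mulr1 // mulrNN mulr1. Qed.
Lemma sgcC b : (sgc b)^* = sgc b. Proof. by case: b; rewrite /= ?rmorphN rmorph1. Qed.
Lemma sgcN b : `|sgc b| = 1. Proof. by case: b; rewrite /= ?normrN normr1. Qed.

Lemma form_signs k n c : (forall i j, k j i = (k i j)^*) ->
  exists w : nat -> bool,
    form k n (fun i => c i * sgc (w i)) <= \sum_(i < n) `|c i| ^+ 2 * k i i.
Proof.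
move=> kH; elim: n => [|n [w IH]].
  by exists (fun=> true); rewrite /form !big_ord0.
pose x := \sum_(i < n) (c i * sgc (w i))^* * c n * k i n.
have [b bx] : exists b, sgc b * (x + x^*) <= 0.
  have xr : x + x^* \is Num.real by apply/CrealP; rewrite rmorphD /= conjCK addrC.
  have := real_leVge xr (@real0 _); case/orP => h.
    by exists true; rewrite mul1r.
  by exists false; rewrite /= mulN1r oppr_le0.
exists (fun i => if i == n then b else w i).
rewrite form_recr // big_ord_recr /= eqxx normrM sgcN mulr1 lerD2r.
have -> : \sum_(i < n) (c i * sgc (if i == n :> nat then b else w i))^* *
    (c n * sgc b) * k i n = sgc b * x.
  rewrite /x mulr_sumr; apply: eq_bigr => i _; rewrite ltn_eqF //; ring.
rewrite rmorphM /= sgcC -mulrDr -[leRHS]addr0; apply: lerD => //.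
apply: le_trans IH; rewrite le_eqVlt; apply/orP; left; apply/eqP.
by apply: eq_form => i ilt; rewrite ltn_eqF.
Qed.

Variables (X : Type) (s l : X -> X -> C) (lam : nat -> X).
Hypotheses (sP : psd s) (lP : psd l).
Hypotheses (s0 : forall z, 0 < s z z) (l0 : forall z, 0 < l z z).
Hypothesis interp : interpolating s l lam.

Let sl i j := s (lam i) (lam j).
Let ll i j := l (lam i) (lam j).
Let slP : psd sl. Proof. exact: psd_pullback. Qed.
Let llP : psd ll. Proof. exact: psd_pullback. Qed.
Let t i := knorm l (lam i) / knorm s (lam i).
Let t0 i : 0 < t i. Proof. by rewrite divr_gt0 // sqrtC_gt0. Qed.
Let tC i : (t i)^* = t i. Proof. by rewrite ge0_conj // ltW. Qed.
Let t2 i : t i ^+ 2 * sl i i = ll i i.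
Proof. by rewrite /t expr_div_n /knorm !sqrtCK divfK // gt_eqF. Qed.

Lemma interpolating_form (w : nat -> C) : linf w -> (forall i, (w i)^* = w i) ->
  exists2 K : C, 0 <= K & forall n c,
    form sl n (fun i => c i * (w i * t i)) <= K * form ll n c.
Proof.
move=> wb wr; have [phi [[K /(mult_boundP sP lP) [K0 KP]] phiE]] := interp wb.
exists (K ^+ 2); first exact: exprn_ge0.
move=> n c; rewrite -subr_ge0.
have := psd_form (index_enum 'I_n) (fun i : 'I_n => c i) (fun i : 'I_n => lam i) KP.
congr (0 <= _); rewrite /form mulr_sumr -sumrB; apply: eq_bigr => i _.
rewrite mulr_sumr -sumrB; apply: eq_bigr => j _.
have wtC k : (w k * t k)^* = w k * t k by rewrite rmorphM /= wr tC.
have -> : (c i * (w i * t i))^* = (c i)^* * (w i * t i) by rewrite rmorphM /= wtC.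
have phit k : phi (lam k) = w k * t k by rewrite phiE -mulrA.
by rewrite !phit wtC /sl /ll; ring.
Qed.

Lemma interpolating_single : exists K : nat -> C, forall i, 0 <= K i /\
  forall n c, (i < n)%N -> `|c i| ^+ 2 * ll i i <= K i * form ll n c.
Proof.
suff /choice : forall i, exists K : C, 0 <= K /\
  forall n c, (i < n)%N -> `|c i| ^+ 2 * ll i i <= K * form ll n c.
  by move=> [K KP]; exists K => i; exact: KP.
move=> i.
have [||K K0 KP] := @interpolating_form (fun j => (j == i)%:R).
- by exists 1; split=> // j; case: eqP; rewrite ?normr1 ?normr0.
- by move=> j; rewrite conjC_nat.
exists K; split=> // n c ilt; apply: le_trans (KP n c).
rewrite (@form_single _ _ _ i) // => [|j /negPf->]; last by rewrite mul0r mulr0.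
rewrite eqxx mul1r normrM exprMn (ger0_norm (ltW (t0 i))). by rewrite -[leRHS]mulrA t2.
Qed.

Lemma interpolating_initial : exists A : nat -> C, forall m, 0 <= A m /\
  forall n c v, (forall i, `|v i| <= 2) -> (forall i, (m <= i)%N -> v i = 0) ->
    form sl n (fun i => c i * (v i * t i)) <= A m * form ll n c.
Proof.
have [K KP] := interpolating_single.
exists (fix A m := if m is m'.+1 then 2 * A m' + 8 * K m' else 0).
elim=> [|m [A0 IH]].
  split=> // n c v _ v0; rewrite mul0r le_eqVlt; apply/orP; left; apply/eqP.
  rewrite /form big1 // => i _; rewrite big1 // => j _.
  by rewrite !v0 // mul0r mulr0 conjC0 !mul0r.
have [Km0 Km] := KP m.
split=> [|n c v v2 v0]; first by rewrite addr_ge0 ?mulr_ge0.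
have -> : form sl n (fun i => c i * (v i * t i)) =
  form sl n (fun i => c i * ((if (i < m)%N then v i else 0) * t i) +
                      c i * ((if i == m then v i else 0) * t i)).
  apply: eq_form => i _; have [im|mi|->] := ltngtP i m; rewrite ?mul0r ?mulr0 ?addr0 ?add0r //.
  by rewrite v0 // mul0r mulr0.
apply: le_trans (form_add_le _ _ _ slP) _; rewrite [leRHS]mulrDl; apply: lerD.
  rewrite -mulrA; apply: ler_wpM2l => //; apply: IH => [i|i mi]; first by case: ifP; rewrite ?normr0.
  by rewrite ltnNge mi.
have -> : 8 * K m * form ll n c = 2 * (4 * (K m * form ll n c)) by ring.
apply: ler_wpM2l => //; have [mn|nm] := ltnP m n; last first.
  apply: (@le_trans _ _ 0); last by rewrite !mulr_ge0 // form_ge0.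
  rewrite le_eqVlt; apply/orP; left; apply/eqP.
  rewrite /form big1 // => i _; rewrite big1 // => j _.
  by rewrite ltn_eqF ?(leq_trans (ltn_ord i)) // mul0r mulr0 conjC0 !mul0r.
rewrite (@form_single _ _ _ m) // => [|j /negPf->]; last by rewrite mul0r mulr0.
rewrite eqxx normrM [`|v m * t m|]normrM (ger0_norm (ltW (t0 m))) 2!exprMn.
have -> : `|c m| ^+ 2 * (`|v m| ^+ 2 * t m ^+ 2) * sl m m = `|v m| ^+ 2 * (`|c m| ^+ 2 * ll m m).
  by rewrite -t2; ring.
apply: ler_pM; rewrite ?exprn_ge0 //; last by apply: Km.
- by rewrite mulr_ge0 ?exprn_ge0 ?psd_diag.
- have -> : 4 = 2 ^+ 2 :> C by ring.
  by rewrite lerXn2r ?nnegrE.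
Qed.

(* Gliding hump: sign patterns violating larger and larger bounds are spliced on
   disjoint blocks into a single pattern violating all of them. *)
Lemma interpolating_uniform : exists2 K : C, 0 <= K & forall n c (w : nat -> bool),
  form sl n (fun i => c i * (sgc (w i) * t i)) <= K * form ll n c.
Proof.
have [A AP] := interpolating_initial.
apply: contrapT => unbounded.
have bad (p : nat * nat) : exists q : nat * (nat -> C) * (nat -> bool),
   (2 * p.1%:R + 2 * A p.2) * form ll q.1.1 q.1.2 <
   form sl q.1.1 (fun i => q.1.2 i * (sgc (q.2 i) * t i)).
  have [A0 _] := AP p.2.
  apply: contrapT => h; apply: unbounded.
  exists (2 * p.1%:R + 2 * A p.2); first by rewrite addr_ge0 ?mulr_ge0 ?ler0n.
  move=> n c w; rewrite real_leNgt ?ger0_real ?mulr_ge0 ?addr_ge0 ?mulr_ge0 ?ler0n ?form_ge0 //.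
  by apply/negP => lt; apply: h; exists (n, c, w).
have [pick pickP] := choice bad.
pose st := fix st j : nat * (nat -> bool) := if j is j'.+1 then
   let m := (st j').1 in let q := pick (j', m) in
   ((maxn m q.1.1).+1, fun i => if (i < m)%N then (st j').2 i else q.2 i) else (0%N, fun=> true).
have st_lt j : ((st j).1 < (st j.+1).1)%N by rewrite /= ltnS leq_maxl.
have st_ge j : (j <= (st j).1)%N.
  by elim: j => // j IH; apply: leq_ltn_trans IH (st_lt j).
have st_stable i j k : (i < (st j).1)%N -> (st (k + j)%N).2 i = (st j).2 i.
  move=> ij; elim: k => // k IH; rewrite addSn /= -[RHS]IH ifT //.
  apply: leq_trans ij _; elim: k {IH} => // k IH; apply: leq_trans IH _; exact/ltnW/st_lt.
pose w i := (st i.+1).2 i.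
have wE i j : (i < (st j).1)%N -> w i = (st j).2 i.
  move=> ij; rewrite /w; have [h|h] := leqP j i.+1.
    by rewrite -(subnK h) st_stable.
  by rewrite -(st_stable i i.+1 (j - i.+1)%N) ?subnK // ltnW.
have [||K K0 KP] := @interpolating_form (fun i => sgc (w i)).
- by exists 1; split=> // i; rewrite sgcN.
- by move=> i; rewrite sgcC.
have [j Kj] := natC_unbounded K0.
have := pickP (j, (st j).1); set q := pick _.
set n := q.1.1; set c := q.1.2; set v := q.2; set m := (st j).1 => /=.
apply/negP; rewrite le_gtF //.
have [_ /(_ n c (fun i => if (i < m)%N then sgc (v i) - sgc (w i) else 0))] := AP m.
have L0 : 0 <= form ll n c by exact: form_ge0.
move=> h.
have -> : form sl n (fun i => c i * (sgc (v i) * t i)) =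
  form sl n (fun i => c i * (sgc (w i) * t i) +
     c i * ((if (i < m)%N then sgc (v i) - sgc (w i) else 0) * t i)).
  apply: eq_form => i ilt; case: ltnP => im; first by ring.
  have -> : w i = v i; last by rewrite mul0r mulr0 addr0.
  have ij : (i < (st j.+1).1)%N by rewrite /= ltnS leq_max (ltnW ilt) orbT.
  by rewrite (wE _ _ ij) /= ltnNge im.
apply: le_trans (form_add_le _ _ _ slP) _.
rewrite [leRHS]mulrDl; apply: lerD; rewrite -mulrA; apply: ler_wpM2l => //.
  by apply: le_trans (KP n c) _; apply: ler_wpM2r.
apply: h => [i|i mi]; last by rewrite ltnNge mi.
case: ifP => _; last by rewrite normr0.
by apply: le_trans (ler_normB _ _) _; rewrite !sgcN.
Qed.

Lemma interpolating_carleson : carleson s lam.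
Proof.
have [K K0 KP] := interpolating_uniform.
exists (K + 1); split=> [|f c [c0 fc] N]; first by rewrite ltr_wpDl.
pose a i := f (lam i) / sl i i.
set E := \sum_(i < N) _.
have slc i : (sl i i)^* = sl i i by rewrite ge0_conj ?psd_diag.
have sln i : sl i i != 0 by rewrite gt_eqF // s0.
have EE : E = \sum_(i < N) (a i)^* * f (lam i).
  apply: eq_bigr => i _; rewrite /knorm sqrtCK normCK /a rmorphM fmorphV /= slc -/(sl i i).
  by rewrite [f _ * _]mulrC mulrAC.
have E0 : 0 <= E by apply: sumr_ge0 => i _; rewrite divr_ge0 ?exprn_ge0 // sqrtC_ge0 psd_diag.
have := fc [seq (a i, lam i) | i <- index_iota 0 N].
rewrite big_map big_mkord /= -EE (ger0_norm E0).
have -> : combo_norm2 s [seq (a i, lam i) | i <- index_iota 0 N] = form sl N a.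
  by rewrite /combo_norm2 big_map big_mkord; apply: eq_bigr => i _; rewrite big_map big_mkord.
have aE : form sl N a <= K * E.
  have [w wP] := form_signs N (fun i => a i / t i) (fun i j => psd_herm i j llP).
  have := KP N (fun i => a i / t i * sgc (w i)) w.
  have -> : form sl N (fun i => a i / t i * sgc (w i) * (sgc (w i) * t i)) = form sl N a.
    apply: eq_form => i _; rewrite mulrA -[_ * sgc _ * sgc _]mulrA sgc2 mulr1 divfK //.
    by rewrite gt_eqF.
  move/le_trans; apply; apply: ler_wpM2l => //; apply: le_trans wP _.
  rewrite le_eqVlt; apply/orP; left; apply/eqP; apply: eq_bigr => i _.
  rewrite -t2 normrM exprMn normfV (ger0_norm (ltW (t0 i))) exprVn /a normrM exprMn normfV.
  rewrite (ger0_norm (ltW (s0 _))) /knorm sqrtCK -/(sl i i).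
  have tn : t i != 0 by rewrite gt_eqF.
  by have sn := sln i; move: (`|f _|) (t i) (sl i i) tn sn => u v y vn yn; field; rewrite vn yn.
move=> h; have [->|En] := eqVneq E 0; first by rewrite mulr_ge0 ?addr_ge0 ?exprn_ge0.
have Ep : 0 < E by rewrite lt_def En.
rewrite -(ler_pM2r Ep) -expr2; apply: le_trans h _.
have -> : (K + 1) * c ^+ 2 * E = c ^+ 2 * (K * E) + c ^+ 2 * E by ring.
apply: le_trans (ler_wpM2l _ aE) _; first exact: exprn_ge0.
by rewrite lerDl mulr_ge0 ?exprn_ge0.
Qed.

Lemma interpolating_separated : strongly_separated l lam.
Proof.
have [K K0 KP] := interpolating_uniform.
have K1 : 0 < K + 1 by rewrite ltr_wpDl.
have lower n (c : nat -> C) : \sum_(i < n) `|c i| ^+ 2 * ll i i <= K * form ll n c.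
  have [|w wP] := @form_signs (fun i j => - sl i j) n (fun i => c i * t i) _.
    by move=> i j; rewrite rmorphN /= -(psd_herm _ _ slP).
  apply: le_trans (KP n c w).
  rewrite -lerN2; apply: le_trans _ (le_trans wP _); rewrite le_eqVlt; apply/orP; left; apply/eqP.
    rewrite /form -sumrN; apply: eq_bigr => i _; rewrite -sumrN; apply: eq_bigr => j _.
    by rewrite !rmorphM /=; ring.
  rewrite -sumrN; apply: eq_bigr => i _.
  by rewrite -t2 normrM exprMn (ger0_norm (ltW (t0 i))); ring.
exists (sqrtC (K + 1)^-1); split; first by rewrite sqrtC_gt0 invr_gt0.
move=> i cs ncs; rewrite sqrtCK.
have kP : psd (fun a b => (K + 1) * ll a b - ((a == i)%:R * (b == i)%:R) * ll i i).
  apply: psd_nat => n c.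
  have -> : \sum_(a < n) \sum_(b < n) (c a)^* * c b *
      ((K + 1) * ll a b - (a == i :> nat)%:R * (b == i :> nat)%:R * ll i i)
     = (K + 1) * form ll n c - form (fun a b => (a == i)%:R * (b == i)%:R * ll i i) n c.
    rewrite /form mulr_sumr -sumrB; apply: eq_bigr => a _; rewrite mulr_sumr -sumrB.
    by apply: eq_bigr => b _; ring.
  rewrite subr_ge0.
  apply: (@le_trans _ _ (\sum_(a < n) `|c a| ^+ 2 * ll a a)); last first.
    by apply: le_trans (lower n c) _; apply: ler_wpM2r; rewrite ?form_ge0 // lerDl.
  have nn (a : 'I_n) : 0 <= `|c a| ^+ 2 * ll a a by rewrite mulr_ge0 ?exprn_ge0 // ltW // l0.
  have [ilt|ni] := ltnP i n; last first.
    rewrite /form big1 ?sumr_ge0 // => a _; rewrite big1 // => b _.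
    by rewrite ltn_eqF ?(leq_trans (ltn_ord a)) // mul0r mul0r mulr0.
  rewrite [leRHS](bigD1 (Ordinal ilt)) //= -[leLHS]addr0; apply: lerD; last exact: sumr_ge0.
  have -> : form (fun a b => (a == i)%:R * (b == i)%:R * ll i i) n c =
     form ll n (fun a => (a == i)%:R * c a).
    apply: eq_bigr => a _; apply: eq_bigr => b _; rewrite rmorphM /= conjC_nat.
    by case: eqP => [->|_]; case: eqP => [->|_]; rewrite ?mul0r ?mulr0 ?mul1r ?mul0r ?mulr0.
  rewrite (@form_single _ _ _ i) // => [|j /negPf->]; last by rewrite mul0r.
  by rewrite eqxx mul1r.
have nn : 0 < knorm l (lam i) by rewrite sqrtC_gt0.
have := kP (((knorm l (lam i))^-1, i) :: [seq (- p.1 / knorm l (lam p.2), p.2) | p <- cs]).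
set u := _ :: _.
have -> : combo_norm2 (fun a b => (K + 1) * ll a b - (a == i)%:R * (b == i)%:R * ll i i) u =
   (K + 1) * combo_norm2 ll u - combo_norm2 (fun a b => (a == i)%:R * (b == i)%:R * ll i i) u.
  rewrite /combo_norm2 mulr_sumr -sumrB; apply: eq_bigr => a _; rewrite mulr_sumr -sumrB.
  by apply: eq_bigr => b _; ring.
have -> : combo_norm2 (fun a b => (a == i)%:R * (b == i)%:R * ll i i) u = 1.
  have z (F : C * nat -> C) : (forall p, p.2 != i -> F p = 0) ->
      \sum_(p <- u) F p = F ((knorm l (lam i))^-1, i).
    move=> F0; rewrite /u big_cons big_map big_seq big1 ?addr0 // => p pc.
    by apply: F0; move/allP: ncs => /(_ _ pc).
  rewrite /combo_norm2 z => [|p /negPf ->]; last by rewrite big1 // => q _; rewrite !mul0r mulr0.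
  rewrite z => [|p /negPf->]; last by rewrite mulr0 mul0r mulr0.
  rewrite /= eqxx !mul1r fmorphV /= (ge0_conj (ltW nn)) -invfM -expr2 /knorm sqrtCK mulVf //.
  by rewrite gt_eqF // l0.
rewrite subr_ge0 => h; rewrite -[leLHS]mulr1 ler_pdivrMl //; apply: le_trans h _.
rewrite le_eqVlt; apply/orP; left; apply/eqP; congr (_ * _).
by rewrite /combo_norm2 /u !big_cons !big_map /=; congr (_ + _);
  apply: eq_bigr => p _; rewrite !big_cons !big_map.
Qed.

End Converse.

Lemma inner_product_psd (R : realType) (X : Type) (V : lmodType R[i]) (ip : V -> V -> R[i])
  (b : X -> V) : inner_product ip -> psd (fun z w => ip (b z) (b w)).
Proof.
move=> [lin herm pos _] u.
have ip0 v : ip 0 v = 0.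
  have := lin 1 0 0 v; rewrite scale1r addr0 mul1r => /eqP.
  by rewrite -subr_eq0 opprD addNKr oppr_eq0 => /eqP.
have suml v : ip (\sum_(p <- u) (p.1)^* *: b p.2) v = \sum_(p <- u) (p.1)^* * ip (b p.2) v.
  by elim: u => [|p u IH]; rewrite ?big_nil // !big_cons lin IH.
have := pos (\sum_(p <- u) (p.1)^* *: b p.2); congr (0 <= _).
rewrite suml /combo_norm2; apply: eq_bigr => p _.
rewrite herm suml rmorph_sum mulr_sumr; apply: eq_bigr => q _.
by rewrite rmorphM /= conjCK -herm mulrA.
Qed.

Theorem theorem3p2 (R : realType) (X : Type) (s l : X -> X -> R[i])
  (lam : nat -> X) :
  normalized_complete_Pick s ->
  psd l ->
  quotient_psd l s ->
  (forall z, (fun x => l x z) <> (fun _ => 0)) ->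
  (interpolating s l lam <-> carleson s lam /\ strongly_separated l lam) /\
  (interpolating s l lam ->
     exists T : (nat -> R[i]) -> (X -> R[i]),
       [/\ forall (a : R[i]) (w v : nat -> R[i]), linf w -> linf v ->
             T (fun i => a * w i + v i) = (fun x => a * T w x + T v x),
           exists K : R[i], 0 <= K /\
             forall w M, linf_bound w M -> mult_bound s l (T w) (K * M)
         & forall w, linf w -> forall j,
             T w (lam j) = w j * knorm l (lam j) / knorm s (lam j)]).
Proof.
move=> [V [ip [b [w0 [[ipP _] b1 _ sE]]]]] lP [g [gP lE]] lnz.
pose B z w := ip (b z) (b w).
have BP : psd B by exact: inner_product_psd.
have {}sE : s = pick_kernel B by apply/funext => z; apply/funext => w; exact: sE.
rewrite {}sE in lE *.
have l0 z : 0 < l z z.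
  rewrite lt_def psd_diag // andbT; apply/negP => /eqP z0; apply: (lnz z).
  by apply/funext => x; exact: psd_null.
have s0 z : 0 < pick_kernel B z z by rewrite invr_gt0 subr_gt0 b1.
have sP := pick_kernel_psd BP b1.
have forward := carleson_separated_interpolation BP b1 gP lE l0.
have backward : interpolating (pick_kernel B) l lam ->
    carleson (pick_kernel B) lam /\ strongly_separated l lam.
  by move=> h; split; [exact: interpolating_carleson h|exact: interpolating_separated h].
split; last by move=> /backward[]; exact: forward.
split=> // -[/forward h /h [T [_ [K [K0 TK]] TE]]] w wb.
exists (T w); split; last exact: TE.
by have [M wM] := wb; exists (K * M); exact: TK.
Qed.
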